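(* Let $q$ be a positive integer. There are infinitely many $k_0\in\mathbb{N}$ for which the amplitude $a_0>0$ defined by $$a_0^{-2}=\frac{2}{q}-\frac{1}{k_0^2q^2}$$ is non-resonant for the lattice point $(1,k_0,0)$, where $p:=qk_0^2-1$ and $\nu:=p/q$. Moreover, for each such non-resonant $a_0$ there is a local continuum of $2\pi q/p$-periodic (in $t$) solutions of $$\partial_t^2w_1=-\partial_s^4w_1+\partial_s^2\left(|w_1|^{-2}w_1\right),\qquad w_1(t,s)\in\mathbb{C},$$ $2\pi$-periodic in $s$, bifurcating from the constant solution $w_1\equiv a_0$. More precisely, there are $b_0>0$ and a continuous family of such solutions $w_1=w_1(\cdot,\cdot;b)$, $b\in[0,b_0]$, with $w_1(\cdot,\cdot;0)\equiv a_0$, which are standing waves satisfying the symmetries $$w_1(t,s)=w_1(-t,s)=w_1(t,-s)=w_1(t,s+2\pi/k_0)=\overline{w_1}\left(t+l_0(q\pi/p),s\right)$$ and the estimate $$w_1(t,s)=a_0+i^{l_0}\,b\cos(pt/q)\cos(k_0s)+\mathcal{O}_{C^4}(b^2),$$ both with $l_0=0$.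
   Context: The equation governs the distance $w_1=u_1-u_2$ between two almost parallel vortex filaments with opposite circulations; each constant $w_1\equiv a$, $a>0$, is a solution (straight filaments at distance $a$). For $\nu=p/q$ and $a>0$ put $$\lambda_{j,k,l}(a)=(\nu j)^2-k^4+(-1)^l a^{-2}k^2,\qquad (j,k,l)\in(\mathbb{Z}^2\setminus\{(0,0)\})\times\{0,1\}.$$ Let $N=\{(j,k,l)\in(\mathbb{Z}^2\setminus\{(0,0)\})\times\{0,1\}:\lambda_{j,k,l}(a_0)=0\}$. Definition: $a_0$ is non-resonant for the lattice point $(j_0,k_0,l_0)\in\mathbb{N}^2\times\{0,1\}$ if $$N\cap(j_0\mathbb{Z}\times k_0\mathbb{Z}\times\{0,1\})=\{(\pm j_0,\pm k_0,l_0)\}$$ (all four sign choices). $\mathbb{N}$ denotes the positive integers. The notation $\mathcal{O}_{C^4}(b^2)$ means a function of $(t,s)$ whose $C^4$ norm is at most $Cb^2$ with $C$ independent of $b\in[0,b_0]$. *)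

(* Defs.v *)
(* Stdlib reals, with Coquelicot's complex numbers [C] and calculus. *)
From Stdlib Require Import Reals ZArith.
From Coquelicot Require Import Coquelicot.

Local Open Scope R_scope.

Definition lambda (nu a : R) (j k : Z) (l : nat) : R :=
  (nu * IZR j) ^ 2 - IZR k ^ 4 + (-1) ^ l * / a ^ 2 * IZR k ^ 2.

(* The set N of zeros of [lambda] over (Z^2 \ {(0,0)}) x {0,1}. *)
Definition resonant_set (nu a : R) (j k : Z) (l : nat) : Prop :=
  (j, k) <> (0%Z, 0%Z) /\ (l = 0%nat \/ l = 1%nat) /\ lambda nu a j k l = 0.

Definition sublattice (j0 k0 : nat) (j k : Z) (l : nat) : Prop :=
  (Z.of_nat j0 | j)%Z /\ (Z.of_nat k0 | k)%Z /\ (l = 0%nat \/ l = 1%nat).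

Definition nonresonant (nu a : R) (j0 k0 l0 : nat) : Prop :=
  forall (j k : Z) (l : nat),
    resonant_set nu a j k l /\ sublattice j0 k0 j k l <->
    (j = Z.of_nat j0 \/ j = (- Z.of_nat j0)%Z) /\
    (k = Z.of_nat k0 \/ k = (- Z.of_nat k0)%Z) /\ l = l0.

Definition freq_p (q k0 : nat) : Z := (Z.of_nat q * Z.of_nat k0 ^ 2 - 1)%Z.

Definition freq_nu (q k0 : nat) : R := IZR (freq_p q k0) / INR q.

Definition is_amplitude (q k0 : nat) (a0 : R) : Prop :=
  0 < a0 /\ / a0 ^ 2 = 2 / INR q - 1 / (INR k0 ^ 2 * INR q ^ 2).

(* Partial derivatives of a complex function of (t, s), taken componentwise.
   As [Derive] is total, they are meaningful only together with [is_Cn]. *)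
Definition Dt (f : R -> R -> C) (t s : R) : C :=
  (Derive (fun x => fst (f x s)) t, Derive (fun x => snd (f x s)) t).

Definition Ds (f : R -> R -> C) (t s : R) : C :=
  (Derive (fun y => fst (f t y)) s, Derive (fun y => snd (f t y)) s).

Definition jointly_continuous (f : R -> R -> C) : Prop :=
  forall z : R * R, continuous (fun z : R * R => f (fst z) (snd z)) z.

(* Class C^n: all partial derivatives up to order n, in every order of
   differentiation, exist and are jointly continuous. *)
Fixpoint is_Cn (n : nat) (f : R -> R -> C) : Prop :=
  jointly_continuous f /\
  match n with
  | O => True
  | S n' =>
      (forall t s : R,
         ex_derive (V := C_R_NormedModule) (fun x => f x s) t /\
         ex_derive (V := C_R_NormedModule) (fun y => f t y) s) /\
      is_Cn n' (Dt f) /\ is_Cn n' (Ds f)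
  end.

(* f is of class C^n and its C^n norm, the largest supremum over R^2 of a
   partial derivative of order at most n, is at most M. *)
Definition Cn_norm_le (n : nat) (f : R -> R -> C) (M : R) : Prop :=
  is_Cn n f /\
  forall i j : nat, (i + j <= n)%nat -> forall t s : R,
    Cmod (Nat.iter i Dt (Nat.iter j Ds f) t s) <= M.

Definition nonlinearity (w : R -> R -> C) (t s : R) : C :=
  (RtoC (/ Cmod (w t s) ^ 2) * w t s)%C.

(* Classical solutions; w is required not to vanish, so that |w|^{-2} w is
   defined (and of class C^4). *)
Definition is_solution (w : R -> R -> C) : Prop :=
  is_Cn 4 w /\
  (forall t s : R, w t s <> RtoC 0) /\
  forall t s : R,
    Nat.iter 2 Dt w t s =
    (- Nat.iter 4 Ds w t s + Nat.iter 2 Ds (nonlinearity w) t s)%C.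

Definition periodic_t (T : R) (w : R -> R -> C) : Prop :=
  forall t s : R, w (t + T) s = w t s.

Definition periodic_s (L : R) (w : R -> R -> C) : Prop :=
  forall t s : R, w t (s + L) = w t s.

Definition standing_wave_symmetries (p : Z) (q k0 l0 : nat)
    (w : R -> R -> C) : Prop :=
  forall t s : R,
    w t s = w (- t) s /\
    w t s = w t (- s) /\
    w t s = w t (s + 2 * PI / INR k0) /\
    w t s = Cconj (w (t + INR l0 * (INR q * PI / IZR p)) s).

Definition leading_term (p : Z) (q k0 l0 : nat) (a0 b t s : R) : C :=
  (RtoC a0 +
   Ci ^ l0 * RtoC (b * cos (IZR p * t / INR q) * cos (INR k0 * s)))%C.

(* Continuity of b |-> w b from [0, b0] to C^4 with the C^4 norm. *)
Definition continuous_family (b0 : R) (w : R -> R -> R -> C) : Prop :=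
  forall b : R, 0 <= b <= b0 ->
  forall eps : R, 0 < eps ->
  exists delta : R, 0 < delta /\
  forall b' : R, 0 <= b' <= b0 -> Rabs (b' - b) < delta ->
    Cn_norm_le 4 (fun t s => w b' t s - w b t s)%C eps.

(* Main.v *)
(* Real solutions suffice (l_0 = 0). Writing u for the solution and v = 1/u, the equation is
   u v = 1, u_tt + u_ssss = v_ss. Both are expanded in powers of b with trigonometric
   polynomials as coefficients; order n then reads L u_n = (r_n)_ss, where
   L = d_tt + d_ssss + a_0^-2 d_ss has the symbol -lambda and r_n depends on lower orders.
   There are no small divisors: q^2 lambda(j, k_0 m, 0) is the integer
   A^2 - B^2 + 2 B - m^2 with A = p|j| and B = q k_0^2 m^2, which is at least m^2 when
   A >= B and at most 1 - m^2 when A < B. Being an integer, it has modulus at least 3 m^2/4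
   unless it vanishes, so L^-1 d_ss is bounded in the l^1 norm of Fourier coefficients.
   The mean value of u_n is in the kernel of L and not determined at order n; it is chosen
   so as to remove the (1, 1) mode of r_{n+1}. A majorant argument gives geometric growth of
   the l^1 norms, and since u_n has degree at most n, all derivatives converge as well. *)

Require Import Defs.
From Stdlib Require Import Reals ZArith.
From Coquelicot Require Import Coquelicot.
From Stdlib Require Import Lia Lra List FunctionalExtensionality.
Import ListNotations.

Local Open Scope R_scope.

(** The choice of [a0] completes a square: q^2 lambda(j, k0 m, 0) = A^2 - (B - 1)^2 + 1 - m^2. For q
    k0^2 >= 2 a zero other than the origin forces m^2 = 1 and A = B - 1, so every [k0 >= 2] is
    admissible. The second unknown v makes the nonlinearity quadratic, so each order only multiplies
    finitely many trigonometric polynomials. The obstacle is the kernel of L, spanned by 1 and the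
    (1, 1) mode. A second s-derivative has no mean value, so each order leaves one constant free,
    while the next order poses one solvability condition. Shifting the mean value of u_n by c
    changes the (1, 1) coefficient of r_{n+1} by 2 c / a0^3, which is -c times the derivative of
    a^-2 at a0: the kernel eigenvalue crosses zero transversally as the amplitude varies, and the
    condition can always be met. The price is that order n involves products of total index n + 1,
    which a plain geometric majorant does not tolerate; the extra gain comes from order 1 being
    absent from those products. As no (1, 1) mode is added at orders n >= 2, b is exactly the
    amplitude of that mode. *)

(** * Divisors *)

(* [q^2 lambda] for [Q = q k0^2], at the lattice point [(j, k0 m)] and with [sg = (-1)^l]. *)
Definition scaled_lambda (Q j m sg : Z) : Z :=
  ((Q - 1) ^ 2 * j ^ 2 - Q ^ 2 * m ^ 4 + sg * (2 * Q - 1) * m ^ 2)%Z.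

Lemma scaled_lambda_squares (Q j m sg : Z) :
  scaled_lambda Q j m sg =
  (((Q - 1) * Z.abs j) ^ 2 - (Q * m ^ 2) ^ 2 + sg * (2 * (Q * m ^ 2) - m ^ 2))%Z.
Proof.
  unfold scaled_lambda. destruct (Z.abs_spec j) as [[_ ->]|[_ ->]]; ring.
Qed.

Lemma scaled_lambda_lower (Q j m : Z) :
  (1 <= Q)%Z -> scaled_lambda Q j m 1 <> 0%Z ->
  (3 * m ^ 2 <= 4 * Z.abs (scaled_lambda Q j m 1))%Z.
Proof.
  intros hQ hne. pose proof (scaled_lambda_squares Q j m 1) as e.
  destruct (Z.eq_dec m 0) as [->|hm]; [lia|].
  remember ((Q - 1) * Z.abs j)%Z as A eqn:eA. remember (Q * m ^ 2)%Z as B eqn:eB.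
  rewrite e in hne |- *; clear e.
  assert (hm2 : (1 <= m ^ 2)%Z) by nia.
  assert (hA : (0 <= A)%Z) by (subst A; nia).
  assert (hB : (m ^ 2 <= B)%Z) by (subst B; nia).
  clear eA eB.
  destruct (Z_le_gt_dec B A) as [h|h].
  - assert (B ^ 2 <= A ^ 2)%Z by nia. lia.
  - assert (A ^ 2 <= (B - 1) ^ 2)%Z by nia.
    (* The factor 3/4 comes from m^2 = 4, where m^2 - 1 = 3 m^2 / 4. For m^2 = 1 the bound 1 - m^2 =
       0 says nothing beyond the sign, and integrality gives modulus at least 1. *)
    assert (h4 : (m ^ 2 = 1 \/ 4 <= m ^ 2)%Z).
    { assert (m = 1 \/ m = -1 \/ 2 <= Z.abs m)%Z as [->|[->|h2]] by lia;
        [now left | now left | right; nia]. }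
    destruct h4; lia.
Qed.

(** If A >= B the value is positive, so A <= B - 1 and the value is at most 1 - m^2. Hence m^2 = 1,
    and equality throughout gives A = B - 1, that is (Q - 1)|j| = Q - 1; here Q >= 2 allows the
    division. *)
Lemma scaled_lambda_zero (Q j m : Z) :
  (2 <= Q)%Z -> scaled_lambda Q j m 1 = 0%Z -> (j, m) <> (0%Z, 0%Z) ->
  (j = 1 \/ j = -1)%Z /\ (m = 1 \/ m = -1)%Z.
Proof.
  intros hQ h0 hne. pose proof (scaled_lambda_squares Q j m 1) as e.
  destruct (Z.eq_dec m 0) as [->|hm].
  { exfalso. assert (j <> 0)%Z by congruence. unfold scaled_lambda in h0. nia. }
  remember ((Q - 1) * Z.abs j)%Z as A eqn:eA. remember (Q * m ^ 2)%Z as B eqn:eB.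
  rewrite e in h0; clear e.
  assert (hm2 : (1 <= m ^ 2)%Z) by nia.
  assert (hA : (0 <= A)%Z) by (subst A; nia).
  assert (hB : (2 * m ^ 2 <= B)%Z) by (subst B; nia).
  assert (hlt : (A < B)%Z) by nia.
  assert (A ^ 2 <= (B - 1) ^ 2)%Z by nia.
  assert (m ^ 2 = 1)%Z by lia.
  assert (hAB : (A = B - 1)%Z) by nia.
  assert (Z.abs j = 1)%Z.
  { subst A B. replace (m^2)%Z with 1%Z in * by lia. nia. }
  split; [lia | nia].
Qed.

(** With the opposite sign the value is A^2 - (B + 1)^2 + 1 + m^2: positive as soon as A >= B + 1,
    and at most m^2 - 2 B < 0 when A <= B. *)
Lemma scaled_lambda_neg (Q j m : Z) :
  (2 <= Q)%Z -> scaled_lambda Q j m (-1) = 0%Z -> (j, m) = (0%Z, 0%Z).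
Proof.
  intros hQ h0. pose proof (scaled_lambda_squares Q j m (-1)) as e.
  destruct (Z.eq_dec m 0) as [->|hm].
  { f_equal. unfold scaled_lambda in h0. nia. }
  exfalso.
  remember ((Q - 1) * Z.abs j)%Z as A eqn:eA. remember (Q * m ^ 2)%Z as B eqn:eB.
  rewrite e in h0; clear e.
  assert (hm2 : (1 <= m ^ 2)%Z) by nia.
  assert (hA : (0 <= A)%Z) by (subst A; nia).
  assert (hB : (m ^ 2 < B)%Z) by (subst B; nia).
  clear eA eB.
  destruct (Z_le_gt_dec A B) as [h|h]; nia.
Qed.

(** The definition of [a0] amounts to q^2 k0^2 / a0^2 = 2 Q - 1 with Q = q k0^2, which turns the
    scaled divisor into an integer. *)
Lemma amplitude_lambda (q k0 : nat) (a0 : R) (j m : Z) (l : nat) :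
  (0 < q)%nat -> (0 < k0)%nat -> is_amplitude q k0 a0 ->
  INR q ^ 2 * lambda (freq_nu q k0) a0 j (Z.of_nat k0 * m) l =
  IZR (scaled_lambda (Z.of_nat q * Z.of_nat k0 ^ 2) j m ((-1) ^ Z.of_nat l)).
Proof.
  intros hq hk [ha e].
  assert (hq' : INR q <> 0) by (apply not_0_INR; lia).
  assert (hk' : INR k0 <> 0) by (apply not_0_INR; lia).
  unfold lambda. rewrite e. unfold freq_nu, freq_p, scaled_lambda.
  repeat rewrite ?plus_IZR, ?minus_IZR, ?mult_IZR, ?Z.pow_2_r.
  replace (m ^ 4)%Z with (m * m * m * m)%Z by ring.
  replace (IZR ((-1) ^ Z.of_nat l)) with ((-1) ^ l) by (rewrite <- pow_IZR; reflexivity).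
  repeat rewrite ?mult_IZR, <- ?INR_IZR_INZ.
  field. split; assumption.
Qed.

Lemma nonresonant_freq (q k0 : nat) (a0 : R) :
  (0 < q)%nat -> (1 < k0)%nat -> is_amplitude q k0 a0 ->
  nonresonant (freq_nu q k0) a0 1 k0 0.
Proof.
  intros hq hk ha j k l.
  assert (hq2 : INR q ^ 2 <> 0) by (apply pow_nonzero, not_0_INR; lia).
  assert (hQ : (2 <= Z.of_nat q * Z.of_nat k0 ^ 2)%Z) by nia.
  split.
  - intros [(hne & hl & h0) (_ & [m ->] & _)].
    rewrite Z.mul_comm in h0.
    pose proof (amplitude_lambda q k0 a0 j m l hq ltac:(lia) ha) as e.
    rewrite h0, Rmult_0_r in e. apply eq_IZR in e. symmetry in e.
    destruct hl as [-> | ->].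
    + apply scaled_lambda_zero in e; [|assumption|].
      * destruct e as [[->| ->] [->| ->]]; repeat split; lia.
      * intros E. apply hne. injection E as -> ->. f_equal.
    + apply scaled_lambda_neg in e; [|assumption]. exfalso. apply hne.
      injection e as -> ->. reflexivity.
  - intros (hj & hk1 & ->).
    assert (exists m, k = (Z.of_nat k0 * m)%Z /\ (m = 1 \/ m = -1)%Z) as (m & -> & hm).
    { destruct hk1 as [-> | ->]; [exists 1%Z | exists (-1)%Z]; lia. }
    repeat split.
    + intros E; injection E as -> _; lia.
    + now left.
    + apply (Rmult_eq_reg_l (INR q ^ 2)); [|assumption].
      rewrite amplitude_lambda, Rmult_0_r by (assumption || lia).
      apply IZR_eq. unfold scaled_lambda.
      change ((-1) ^ Z.of_nat 0)%Z with 1%Z.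
      destruct hj as [->| ->], hm as [->| ->]; ring.
    + exists j; lia.
    + exists m; lia.
    + now left.
Qed.

Lemma amplitude_exists (q k0 : nat) :
  (0 < q)%nat -> (0 < k0)%nat -> exists a0, is_amplitude q k0 a0.
Proof.
  intros hq hk.
  assert (hq' : 1 <= INR q) by (apply (le_INR 1); lia).
  assert (hk' : 1 <= INR k0) by (apply (le_INR 1); lia).
  set (x := 2 / INR q - 1 / (INR k0 ^ 2 * INR q ^ 2)).
  assert (hx : 0 < x).
  { unfold x. replace (2 / INR q - 1 / (INR k0 ^ 2 * INR q ^ 2))
      with ((2 * INR q * INR k0 ^ 2 - 1) / (INR k0 ^ 2 * INR q ^ 2)) by (field; lra).
    apply Rdiv_lt_0_compat; [|apply Rmult_lt_0_compat; apply pow_lt; lra].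
    assert (1 <= INR k0 ^ 2) by nra. nra. }
  exists (/ sqrt x). assert (hs := sqrt_lt_R0 x hx). split.
  - now apply Rinv_0_lt_compat.
  - rewrite pow_inv, Rinv_inv, pow2_sqrt; [reflexivity | lra].
Qed.

(** * Trigonometric polynomials *)

Definition lsum {A : Type} (f : A -> R) (l : list A) : R :=
  fold_right (fun x acc => f x + acc) 0 l.

Lemma lsum_app {A} (f : A -> R) l l' : lsum f (l ++ l') = lsum f l + lsum f l'.
Proof. induction l; simpl; lra. Qed.

Lemma lsum_cons {A} (f : A -> R) x l : lsum f (x :: l) = f x + lsum f l.
Proof. reflexivity. Qed.

Lemma lsum_flat_map {A B} (f : B -> R) (g : A -> list B) l :
  lsum f (flat_map g l) = lsum (fun x => lsum f (g x)) l.
Proof. induction l; simpl; rewrite ?lsum_app; lra. Qed.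

Lemma lsum_map {A B} (f : B -> R) (g : A -> B) l :
  lsum f (map g l) = lsum (fun x => f (g x)) l.
Proof. induction l; simpl; lra. Qed.

Lemma lsum_scal {A} (f : A -> R) c l : lsum (fun x => c * f x) l = c * lsum f l.
Proof. induction l; simpl; lra. Qed.

Lemma lsum_plus {A} (f g : A -> R) l :
  lsum (fun x => f x + g x) l = lsum f l + lsum g l.
Proof. induction l; simpl; lra. Qed.

Lemma lsum_ext {A} (f g : A -> R) l :
  (forall x, In x l -> f x = g x) -> lsum f l = lsum g l.
Proof. induction l; simpl; intros h; [|rewrite h, IHl]; auto. Qed.

Lemma lsum_le {A} (f g : A -> R) l :
  (forall x, In x l -> f x <= g x) -> lsum f l <= lsum g l.
Proof. induction l; simpl; intros h; [lra|apply Rplus_le_compat]; auto. Qed.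

Lemma lsum_Rabs {A} (f : A -> R) l : Rabs (lsum f l) <= lsum (fun x => Rabs (f x)) l.
Proof.
  induction l; simpl; [rewrite Rabs_R0; lra|].
  eapply Rle_trans; [apply Rabs_triang|]; lra.
Qed.

Lemma lsum_seq (f : nat -> R) n : sum_f_R0 f n = lsum f (seq 0 (S n)).
Proof.
  induction n; [simpl; lra|].
  rewrite seq_S, lsum_app, <- IHn. simpl. lra.
Qed.

Lemma lsum_seq_ends (f : nat -> R) n :
  (1 <= n)%nat -> sum_f_R0 f n = f O + lsum f (seq 1 (n - 1)) + f n.
Proof.
  intros hn. rewrite lsum_seq, seq_S, lsum_app. destruct n; [lia|].
  simpl. rewrite Nat.sub_0_r. lra.
Qed.

(* A term [(c, (j, m))] stands for [c cos(j x) cos(m y)]; modes may repeat. *)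
Definition trigpoly : Type := list (R * (Z * Z)).

(** Point values, partial derivatives at a point and the kernel coefficient are all of this form for
    suitable [chi]. Polynomials are compared only through such functionals, so different lists may
    represent the same function. *)
Definition pairing (chi : Z * Z -> R) (f : trigpoly) : R :=
  lsum (fun x => fst x * chi (snd x)) f.

(** Because modes may repeat, this is only an upper bound for the l^1 norm of the collected
    coefficients; in exchange it is exactly multiplicative. *)
Definition norm1 (f : trigpoly) : R := lsum (fun x => Rabs (fst x)) f.

Definition deg_le (n : nat) (f : trigpoly) : Prop :=
  List.Forall (fun x => Z.abs (fst (snd x)) <= Z.of_nat n /\
                   Z.abs (snd (snd x)) <= Z.of_nat n)%Z f.

Definition scale (a : R) : trigpoly -> trigpoly :=
  map (fun x => (a * fst x, snd x)).

Definition multiplier (mu : Z * Z -> R) : trigpoly -> trigpoly :=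
  map (fun x => (fst x * mu (snd x), snd x)).

(* [cos(j x) cos(j' x) = (cos((j+j') x) + cos((j-j') x)) / 2] in both variables. *)
Definition term_mul (x y : R * (Z * Z)) : trigpoly :=
  let c := fst x * fst y / 4 in
  let (j, m) := snd x in
  let (j', m') := snd y in
  [(c, (j + j', m + m')); (c, (j + j', m - m'));
   (c, (j - j', m + m')); (c, (j - j', m - m'))]%Z.

Definition mul (f g : trigpoly) : trigpoly :=
  flat_map (fun x => flat_map (term_mul x) g) f.

Lemma pairing_app chi f g : pairing chi (f ++ g) = pairing chi f + pairing chi g.
Proof. apply lsum_app. Qed.

Lemma pairing_scale chi a f : pairing chi (scale a f) = a * pairing chi f.
Proof.
  unfold pairing, scale. rewrite lsum_map, <- lsum_scal.
  apply lsum_ext; intros; simpl; lra.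
Qed.

Lemma pairing_flat_map {A} chi (h : A -> trigpoly) l :
  pairing chi (flat_map h l) = lsum (fun i => pairing chi (h i)) l.
Proof. apply lsum_flat_map. Qed.

Lemma pairing_multiplier chi mu f :
  pairing chi (multiplier mu f) = pairing (fun x => mu x * chi x) f.
Proof.
  unfold pairing, multiplier. rewrite lsum_map.
  apply lsum_ext; intros; simpl; ring.
Qed.

Lemma pairing_mul_app_l chi f f' g :
  pairing chi (mul (f ++ f') g) = pairing chi (mul f g) + pairing chi (mul f' g).
Proof. unfold mul. rewrite flat_map_app. apply pairing_app. Qed.

Lemma pairing_mul_app_r chi f g g' :
  pairing chi (mul f (g ++ g')) = pairing chi (mul f g) + pairing chi (mul f g').
Proof.
  unfold mul. rewrite !pairing_flat_map, <- lsum_plus. apply lsum_ext.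
  intros x _. rewrite flat_map_app. apply pairing_app.
Qed.

Lemma pairing_term_mul_scale_r chi a x y :
  pairing chi (term_mul x (a * fst y, snd y)) = a * pairing chi (term_mul x y).
Proof. destruct x as [c [j m]], y as [c' [j' m']]. unfold pairing. simpl. lra. Qed.

Lemma pairing_mul chi f g :
  pairing chi (mul f g) = lsum (fun x => lsum (fun y => pairing chi (term_mul x y)) g) f.
Proof.
  unfold mul. rewrite pairing_flat_map. apply lsum_ext; intros. apply pairing_flat_map.
Qed.

Lemma pairing_mul_scale_r chi a f g :
  pairing chi (mul f (scale a g)) = a * pairing chi (mul f g).
Proof.
  rewrite !pairing_mul. unfold scale. rewrite <- lsum_scal.
  apply lsum_ext; intros. rewrite lsum_map, <- lsum_scal. apply lsum_ext; intros.
  apply pairing_term_mul_scale_r.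
Qed.

Definition mode (x y : R) (jm : Z * Z) : R :=
  cos (IZR (fst jm) * x) * cos (IZR (snd jm) * y).

Lemma pairing_mode_mul x y f g :
  pairing (mode x y) (mul f g) = pairing (mode x y) f * pairing (mode x y) g.
Proof.
  rewrite pairing_mul.
  unfold pairing at 2. rewrite Rmult_comm, <- lsum_scal.
  apply lsum_ext; intros [c [j m]] _. unfold pairing at 2.
  rewrite Rmult_comm, <- lsum_scal. apply lsum_ext; intros [c' [j' m']] _.
  unfold pairing, mode. simpl.
  rewrite ?plus_IZR, ?minus_IZR, ?Rmult_plus_distr_r, ?Rmult_minus_distr_r,
    ?cos_plus, ?cos_minus.
  field.
Qed.

Lemma norm1_nonneg f : 0 <= norm1 f.
Proof. induction f; unfold norm1; simpl; [lra|]. pose proof (Rabs_pos (fst a)). unfold norm1 in *; lra. Qed.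

Lemma norm1_app f g : norm1 (f ++ g) = norm1 f + norm1 g.
Proof. apply lsum_app. Qed.

Lemma norm1_scale a f : norm1 (scale a f) = Rabs a * norm1 f.
Proof.
  unfold norm1, scale. rewrite lsum_map, <- lsum_scal.
  apply lsum_ext; intros; apply Rabs_mult.
Qed.

Lemma norm1_mul f g : norm1 (mul f g) = norm1 f * norm1 g.
Proof.
  unfold norm1, mul. rewrite lsum_flat_map, (Rmult_comm (lsum _ f)), <- lsum_scal.
  apply lsum_ext; intros [c [j m]] _.
  rewrite lsum_flat_map, Rmult_comm, <- lsum_scal.
  apply lsum_ext; intros [c' [j' m']] _. simpl.
  unfold Rdiv. rewrite !Rabs_mult, (Rabs_pos_eq (/ 4)) by lra. field.
Qed.

Lemma pairing_bound chi K f :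
  (forall c jm, In (c, jm) f -> Rabs (chi jm) <= K) -> Rabs (pairing chi f) <= K * norm1 f.
Proof.
  intros h. unfold pairing, norm1. eapply Rle_trans; [apply lsum_Rabs|].
  rewrite <- lsum_scal. apply lsum_le; intros [c jm] hi. simpl.
  rewrite Rabs_mult, Rmult_comm. apply Rmult_le_compat_r; [apply Rabs_pos|eauto].
Qed.

Lemma norm1_multiplier mu K f :
  (forall jm, Rabs (mu jm) <= K) -> norm1 (multiplier mu f) <= K * norm1 f.
Proof.
  intros h. unfold norm1, multiplier. rewrite lsum_map, <- lsum_scal.
  apply lsum_le; intros [c jm] _. simpl.
  rewrite Rabs_mult, Rmult_comm. apply Rmult_le_compat_r; [apply Rabs_pos|auto].
Qed.

Lemma deg_le_app n f g : deg_le n f -> deg_le n g -> deg_le n (f ++ g).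
Proof. intros; apply List.Forall_app; auto. Qed.

Lemma deg_le_scale n a f : deg_le n f -> deg_le n (scale a f).
Proof. intros h; apply List.Forall_map. eapply List.Forall_impl; [|exact h]. auto. Qed.

Lemma deg_le_multiplier n mu f : deg_le n f -> deg_le n (multiplier mu f).
Proof. intros h; apply List.Forall_map. eapply List.Forall_impl; [|exact h]. auto. Qed.

Lemma deg_le_mul n n' f g : deg_le n f -> deg_le n' g -> deg_le (n + n') (mul f g).
Proof.
  intros hf hg. apply List.Forall_flat_map. eapply List.Forall_impl; [|exact hf].
  intros [c [j m]] h. apply List.Forall_flat_map. eapply List.Forall_impl; [|exact hg].
  intros [c' [j' m']] h'. unfold term_mul. simpl in *.
  repeat constructor; simpl; lia.
Qed.

Lemma deg_le_flat_map {A} n (h : A -> trigpoly) l :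
  (forall i, In i l -> deg_le n (h i)) -> deg_le n (flat_map h l).
Proof. intros H. apply List.Forall_flat_map, List.Forall_forall, H. Qed.

(** * Formal power series solution *)

(** Each order uses all lower ones, so the recursion runs on tables: [hist n] is final at the
    indices below n, and [step n] consults no others. *)
Lemma course_of_values {X : Type} (x0 : X) (step : nat -> (nat -> X) -> X) :
  (forall n f g, (forall k, (k < n)%nat -> f k = g k) -> step n f = step n g) ->
  exists f, forall n, f n = step n f.
Proof.
  intros hext.
  set (hist := fix hist n := match n with
    | O => fun _ => x0
    | S n' => fun k => if (k =? n')%nat then step n' (hist n') else hist n' k end).
  assert (hstab : forall n k, (k < n)%nat -> hist n k = hist (S k) k).
  { induction n; intros k hk; [lia|].
    destruct (Nat.eq_dec k n) as [->|hne]; [reflexivity|].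
    transitivity (hist n k); [|apply IHn; lia].
    simpl. destruct (Nat.eqb_spec k n); [contradiction|reflexivity]. }
  exists (fun n => hist (S n) n). intros n.
  transitivity (step n (hist n)); [simpl; now rewrite Nat.eqb_refl|].
  apply hext. intros k hk. now apply hstab.
Qed.

(** The four sign choices are the same function cos x cos y, and [term_mul] produces all of them,
    for instance from a constant times [phi]. *)
Definition is_kernel (jm : Z * Z) : bool :=
  ((Z.abs (fst jm) =? 1)%Z && (Z.abs (snd jm) =? 1)%Z)%bool.

Definition kernel_coef : trigpoly -> R :=
  pairing (fun jm => if is_kernel jm then 1 else 0).

Definition phi : trigpoly := [(1, (1, 1)%Z)].

Definition cross (lo len N : nat) (f : nat -> trigpoly * trigpoly) : trigpoly :=
  flat_map (fun i => mul (fst (f i)) (snd (f (N - i)%nat))) (seq lo len).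

(** Order n of u v = 1 reads a v_n + u_n / a + sum_{0<i<n} u_i v_{n-i} = 0, hence v_n = - a^-2 u_n +
    r_n with this r_n. *)
Definition rest (a : R) (n : nat) (f : nat -> trigpoly * trigpoly) : trigpoly :=
  scale (- / a) (cross 1 (n - 1) n f).

(* Chosen so that [rest a (S n)] has no kernel component. *)
Definition mean_shift (a : R) (mu : Z * Z -> R) (n : nat)
    (f : nat -> trigpoly * trigpoly) : R :=
  let r := rest a n f in
  let z := multiplier mu r in
  a ^ 2 / 2 * (kernel_coef (mul phi r) + kernel_coef (cross 2 (n - 2) (S n) f))
  - / 2 * (kernel_coef (mul phi z) + kernel_coef (mul z phi)).

Definition next (a : R) (mu : Z * Z -> R) (n : nat)
    (f : nat -> trigpoly * trigpoly) : trigpoly * trigpoly :=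
  match n with
  | O => ([(a, (0, 0)%Z)], [(/ a, (0, 0)%Z)])
  | S O => (phi, scale (- / a ^ 2) phi)
  | _ =>
      let r := rest a n f in
      let u := [(mean_shift a mu n f, (0, 0)%Z)] ++ multiplier mu r in
      (u, scale (- / a ^ 2) u ++ r)
  end.

Lemma cross_ext lo len N f g :
  (forall k, (k < lo + len)%nat -> f k = g k) ->
  (forall k, (k <= N - lo)%nat -> f k = g k) ->
  cross lo len N f = cross lo len N g.
Proof.
  intros h h'. unfold cross. rewrite !flat_map_concat_map. f_equal.
  apply map_ext_in. intros i hi. apply in_seq in hi.
  rewrite h by lia. rewrite h' by lia. reflexivity.
Qed.

(** The recursion is well founded although [mean_shift] at order n looks at products of total index
    n + 1: their indices i and n + 1 - i with 2 <= i <= n - 1 both stay below n. *)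
Lemma next_ext a mu n f g :
  (forall k, (k < n)%nat -> f k = g k) -> next a mu n f = next a mu n g.
Proof.
  intros h. destruct n as [|[|n]]; try reflexivity.
  assert (hr : rest a (S (S n)) f = rest a (S (S n)) g).
  { unfold rest. f_equal. apply cross_ext; intros; apply h; lia. }
  unfold next, mean_shift. rewrite hr.
  rewrite (cross_ext 2 (S (S n) - 2) (S (S (S n))) f g); [reflexivity| |];
    intros; apply h; lia.
Qed.

Section Coefficients.

Context (a : R) (mu : Z * Z -> R) (f : nat -> trigpoly * trigpoly).
Hypothesis ha : 0 < a.
Hypothesis hf : forall n, f n = next a mu n f.

Notation u n := (fst (f n)).
Notation v n := (snd (f n)).

Lemma u_0 : u 0%nat = [(a, (0, 0)%Z)].
Proof. now rewrite hf. Qed.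
Lemma v_0 : v 0%nat = [(/ a, (0, 0)%Z)].
Proof. now rewrite hf. Qed.
Lemma u_1 : u 1%nat = phi.
Proof. now rewrite hf. Qed.
Lemma v_1 : v 1%nat = scale (- / a ^ 2) phi.
Proof. now rewrite hf. Qed.
Lemma u_ge2 n : (2 <= n)%nat ->
  u n = [(mean_shift a mu n f, (0, 0)%Z)] ++ multiplier mu (rest a n f).
Proof. intros h. rewrite hf. destruct n as [|[|n]]; [lia..|reflexivity]. Qed.
Lemma v_ge1 n : (1 <= n)%nat -> v n = scale (- / a ^ 2) (u n) ++ rest a n f.
Proof.
  intros h. rewrite hf. destruct n as [|[|n]]; [lia|reflexivity|reflexivity].
Qed.

(** With c the mean value of u_N and z its other part, the end terms u_1 v_N and u_N v_1 of order N
    + 1 each contribute - c / a^2 to the kernel coefficient. The rest of that coefficient is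
    independent of c, and [mean_shift] is the solution c of the resulting linear equation. *)
Lemma kernel_coef_rest n : (1 <= n)%nat -> kernel_coef (rest a n f) = 0.
Proof.
  intros hn. destruct n as [|[|[|n]]]; [lia|reflexivity| |].
  (* At order 2 only [phi] times itself occurs, and its modes have entries 0 and 2. *)
  { unfold rest, cross. simpl seq. simpl flat_map. rewrite u_1, v_1.
    unfold kernel_coef, pairing. simpl. lra. }
  unfold kernel_coef, rest. rewrite pairing_scale.
  set (N := S (S n)). unfold cross. rewrite pairing_flat_map.
  assert (e : seq 1 (S N - 1) = 1%nat :: seq 2 (N - 2) ++ [N]).
  { replace (S N - 1)%nat with (S (S n)) by (unfold N; lia).
    simpl. f_equal. replace (n - 0)%nat with n by lia.
    rewrite <- seq_S. reflexivity. }
  rewrite e, lsum_cons, lsum_app, lsum_cons.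
  replace (S N - 1)%nat with N by lia. replace (S N - N)%nat with 1%nat by lia.
  change (lsum _ []) with 0.
  rewrite (v_ge1 N), u_1, v_1, (u_ge2 N) by (unfold N; lia).
  rewrite pairing_mul_app_r, pairing_mul_app_l, !pairing_mul_scale_r,
    pairing_mul_app_r.
  set (S2 := lsum _ (seq 2 _)).
  assert (hS2 : S2 = kernel_coef (cross 2 (N - 2) (S N) f)).
  { unfold kernel_coef, cross. rewrite pairing_flat_map. reflexivity. }
  rewrite hS2.
  assert (h1 : forall c, pairing (fun jm => if is_kernel jm then 1 else 0)
            (mul phi [(c, (0, 0)%Z)]) = c).
  { intros c. unfold pairing. simpl. lra. }
  assert (h2 : forall c, pairing (fun jm => if is_kernel jm then 1 else 0)
            (mul [(c, (0, 0)%Z)] phi) = c).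
  { intros c. unfold pairing. simpl. lra. }
  rewrite h1, h2. unfold mean_shift, kernel_coef.
  field. lra.
Qed.

Lemma product_zero x y n : (1 <= n)%nat ->
  sum_f_R0 (fun i => pairing (mode x y) (u i) * pairing (mode x y) (v (n - i)%nat)) n = 0.
Proof.
  intros hn. rewrite lsum_seq_ends by assumption.
  rewrite Nat.sub_diag, Nat.sub_0_r, u_0, v_0, (v_ge1 n) by assumption.
  rewrite pairing_app, pairing_scale. unfold rest. rewrite pairing_scale.
  unfold cross. rewrite pairing_flat_map.
  rewrite (lsum_ext (fun i => pairing (mode x y) (mul (u i) (v (n - i)%nat)))
     (fun i => pairing (mode x y) (u i) * pairing (mode x y) (v (n - i)%nat)))
    by (intros; apply pairing_mode_mul).
  set (S1 := lsum _ _). set (U := pairing _ (u n)).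
  unfold pairing, mode. simpl. rewrite !Rmult_0_l, cos_0. field. lra.
Qed.

(* Every derivative shifts the phase by a quarter period, so that sines are not needed. *)
Definition dmode (nu k : R) (i l : nat) (t s : R) (jm : Z * Z) : R :=
  (IZR (fst jm) * nu) ^ i * (IZR (snd jm) * k) ^ l *
  (cos (IZR (fst jm) * (nu * t) + INR i * (PI / 2)) *
   cos (IZR (snd jm) * (k * s) + INR l * (PI / 2))).

Lemma cos_quarter_2 x : cos (x + INR 2 * (PI / 2)) = - cos x.
Proof.
  replace (x + INR 2 * (PI / 2)) with (x + PI) by (simpl; field). apply neg_cos.
Qed.

Lemma cos_quarter_4 x : cos (x + INR 4 * (PI / 2)) = cos x.
Proof.
  replace (x + INR 4 * (PI / 2)) with (x + 2 * INR 1 * PI) by (simpl; field).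
  apply cos_period.
Qed.

Lemma dmode_00 nu k t s jm : dmode nu k 0 0 t s jm = mode (nu * t) (k * s) jm.
Proof. unfold dmode, mode. simpl. rewrite !Rmult_0_l, !Rplus_0_r. ring. Qed.

Lemma dmode_20 nu k t s jm :
  dmode nu k 2 0 t s jm = - (IZR (fst jm) * nu) ^ 2 * mode (nu * t) (k * s) jm.
Proof.
  unfold dmode, mode. rewrite cos_quarter_2.
  simpl INR. rewrite !Rmult_0_l, !Rplus_0_r. ring.
Qed.

Lemma dmode_02 nu k t s jm :
  dmode nu k 0 2 t s jm = - (IZR (snd jm) * k) ^ 2 * mode (nu * t) (k * s) jm.
Proof.
  unfold dmode, mode. rewrite cos_quarter_2.
  simpl INR. rewrite !Rmult_0_l, !Rplus_0_r. ring.
Qed.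

Lemma dmode_04 nu k t s jm :
  dmode nu k 0 4 t s jm = (IZR (snd jm) * k) ^ 4 * mode (nu * t) (k * s) jm.
Proof.
  unfold dmode, mode. rewrite cos_quarter_4.
  simpl INR. rewrite !Rmult_0_l, !Rplus_0_r. ring.
Qed.

Lemma mode_kernel x y jm : is_kernel jm = true -> mode x y jm = cos x * cos y.
Proof.
  destruct jm as [j m]. unfold is_kernel, mode. simpl. intros h.
  apply andb_prop in h as [hj hm]. apply Z.eqb_eq in hj, hm.
  assert (e : forall i z, Z.abs i = 1%Z -> cos (IZR i * z) = cos z).
  { intros i z hi. assert (i = 1 \/ i = -1)%Z as [->| ->] by lia.
    - now rewrite Rmult_1_l.
    - replace (-1 * z) with (- z) by ring. apply cos_neg. }
  now rewrite !e.
Qed.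

(** L acts on a mode as multiplication by the negative of this number. *)
Definition symbol (nu k : R) (jm : Z * Z) : R :=
  (IZR (fst jm) * nu) ^ 2 - (IZR (snd jm) * k) ^ 4
  + / a ^ 2 * (IZR (snd jm) * k) ^ 2.

Lemma wave_equation nu k n t s :
  symbol nu k (1, 1)%Z = 0 ->
  (forall jm, mu jm * symbol nu k jm =
     if is_kernel jm then 0 else (IZR (snd jm) * k) ^ 2) ->
  pairing (dmode nu k 2 0 t s) (u n) + pairing (dmode nu k 0 4 t s) (u n)
  = pairing (dmode nu k 0 2 t s) (v n).
Proof.
  intros h11 hmu.
  assert (key : forall g, pairing (dmode nu k 2 0 t s) g + pairing (dmode nu k 0 4 t s) g
     + / a ^ 2 * pairing (dmode nu k 0 2 t s) g
     = pairing (fun jm => - symbol nu k jm * mode (nu * t) (k * s) jm) g).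
  { intros g. unfold pairing. rewrite <- lsum_scal, <- !lsum_plus.
    apply lsum_ext; intros x _. rewrite dmode_20, dmode_02, dmode_04.
    unfold symbol. ring. }
  destruct n as [|n].
  { rewrite u_0, v_0. unfold pairing. simpl.
    rewrite dmode_20, !dmode_02, !dmode_04. simpl. ring. }
  rewrite v_ge1, pairing_app, pairing_scale by lia.
  assert (pairing (dmode nu k 2 0 t s) (u (S n)) + pairing (dmode nu k 0 4 t s) (u (S n))
     + / a ^ 2 * pairing (dmode nu k 0 2 t s) (u (S n))
     = pairing (dmode nu k 0 2 t s) (rest a (S n) f)); [|lra].
  rewrite key. destruct n as [|n].
  { rewrite u_1. unfold pairing, phi. simpl. rewrite h11. ring. }
  rewrite u_ge2, pairing_app by lia. unfold pairing at 1. simpl lsum.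
  replace (symbol nu k (0, 0)%Z) with 0 by (unfold symbol; simpl; ring).
  set (r := rest a (S (S n)) f). rewrite pairing_multiplier.
  pose proof (kernel_coef_rest (S (S n)) ltac:(lia)) as hk. fold r in hk.
  rewrite Ropp_0, Rmult_0_l, Rmult_0_r, !Rplus_0_l.
  (* On kernel modes [mu * symbol] is 0 instead of (m k)^2. The defects add up to a multiple of
     [kernel_coef r], which is zero. *)
  transitivity (pairing (dmode nu k 0 2 t s) r
     + k ^ 2 * cos (nu * t) * cos (k * s) * kernel_coef r); [|rewrite hk; ring].
  unfold kernel_coef, pairing. rewrite <- lsum_scal, <- lsum_plus.
  apply lsum_ext; intros [c jm] _. simpl fst; simpl snd.
  rewrite dmode_02.
  replace (mu jm * (- symbol nu k jm * mode (nu * t) (k * s) jm))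
    with (- (mu jm * symbol nu k jm) * mode (nu * t) (k * s) jm) by ring.
  rewrite hmu. destruct (is_kernel jm) eqn:ek; [|ring].
  rewrite (mode_kernel _ _ _ ek).
  destruct jm as [j m]. unfold is_kernel in ek. simpl in ek |- *.
  apply andb_prop in ek as [_ hm]. apply Z.eqb_eq in hm.
  assert (m = 1 \/ m = -1)%Z as [->| ->] by lia; ring.
Qed.

Lemma deg_le_coefficients n : deg_le n (u n) /\ deg_le n (v n).
Proof.
  induction n as [n IH] using lt_wf_ind.
  destruct n as [|n].
  { rewrite u_0, v_0. split; repeat constructor; simpl; lia. }
  rewrite v_ge1 by lia.
  assert (hr : deg_le (S n) (rest a (S n) f)).
  { apply deg_le_scale, deg_le_flat_map. intros i hi. apply in_seq in hi.
    replace (S n) with (i + (S n - i))%nat at 1 by lia.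
    apply deg_le_mul; apply IH; lia. }
  assert (hu : deg_le (S n) (u (S n))).
  { destruct n as [|n].
    - rewrite u_1. repeat constructor; simpl; lia.
    - rewrite u_ge2 by lia. apply deg_le_app; [|now apply deg_le_multiplier].
      repeat constructor; simpl; lia. }
  split; [exact hu|]. apply deg_le_app; [now apply deg_le_scale|exact hr].
Qed.

End Coefficients.

(** * Growth of the coefficients *)

(** A weight that convolution reproduces up to a constant factor; without it the n - 1 summands of a
    Cauchy product would spoil a geometric bound. *)
Definition inv_sq (n : nat) : R := / INR n ^ 2.

Lemma one_le_INR n : (1 <= n)%nat -> 1 <= INR n.
Proof. intros h. apply (le_INR 1). lia. Qed.

Lemma inv_sq_telescope n : (1 <= n)%nat -> inv_sq n <= 2 * (/ INR n - / INR (S n)).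
Proof.
  intros h. pose proof (one_le_INR n h). unfold inv_sq. rewrite S_INR.
  replace (2 * (/ INR n - / (INR n + 1))) with (2 / (INR n * (INR n + 1))) by (field; lra).
  replace (/ INR n ^ 2) with (1 / (INR n ^ 2)) by (field; lra).
  apply Rle_div_l; [nra|]. unfold Rdiv. rewrite Rmult_assoc.
  rewrite <- Rmult_assoc, (Rmult_comm (2 * _)), <- Rmult_assoc.
  rewrite Rmult_comm.
  replace (/ (INR n * (INR n + 1)) * (INR n ^ 2 * 2)) with (2 * INR n / (INR n + 1)) by (field; lra).
  apply Rle_div_r; lra.
Qed.

Lemma inv_sq_sum len : forall lo, (1 <= lo)%nat ->
  lsum inv_sq (seq lo len) <= 2 * (/ INR lo - / INR (lo + len)).
Proof.
  induction len; intros lo h; simpl seq.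
  { rewrite Nat.add_0_r. simpl. lra. }
  rewrite lsum_cons. specialize (IHlen (S lo) ltac:(lia)).
  pose proof (inv_sq_telescope lo h).
  replace (lo + S len)%nat with (S lo + len)%nat by lia. lra.
Qed.

Lemma inv_sq_sum_rev N len : forall lo, (lo + len <= N)%nat ->
  lsum (fun i => inv_sq (N - i)) (seq lo len) <= 2 * (/ INR (S (N - lo - len)) - / INR (S (N - lo))).
Proof.
  induction len; intros lo h; simpl seq.
  { rewrite Nat.sub_0_r. simpl. lra. }
  rewrite lsum_cons. specialize (IHlen (S lo) ltac:(lia)).
  pose proof (inv_sq_telescope (N - lo) ltac:(lia)).
  replace (N - lo - S len)%nat with (N - S lo - len)%nat by lia.
  replace (S (N - S lo)) with (N - lo)%nat in IHlen by lia. lra.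
Qed.

(** From (x + y)^2 <= 2 (x^2 + y^2) follows 1/(x^2 y^2) <= 2 (x + y)^-2 (x^-2 + y^-2). Each of the
    two remaining sums is at most 2 by telescoping, whence 8 = 2 (2 + 2). *)
Lemma inv_sq_convolution N lo len : (1 <= lo)%nat -> (lo + len <= N)%nat ->
  lsum (fun i => inv_sq i * inv_sq (N - i)) (seq lo len) <= 8 * inv_sq N.
Proof.
  intros h1 h2.
  destruct len as [|len].
  { simpl. unfold inv_sq. destruct N; [lia|]. pose proof (one_le_INR (S N) ltac:(lia)).
    assert (0 < / INR (S N) ^ 2) by (apply Rinv_0_lt_compat; nra). lra. }
  assert (hN : 0 < inv_sq N).
  { unfold inv_sq. pose proof (one_le_INR N ltac:(lia)). apply Rinv_0_lt_compat; nra. }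
  apply Rle_trans with (lsum (fun i => 2 * inv_sq N * (inv_sq i + inv_sq (N - i))) (seq lo (S len))).
  - apply lsum_le. intros i hi. apply in_seq in hi. unfold inv_sq.
    pose proof (one_le_INR i ltac:(lia)). pose proof (one_le_INR (N - i) ltac:(lia)).
    replace (INR N) with (INR i + INR (N - i)) by (rewrite <- plus_INR; f_equal; lia).
    set (x := INR i) in *. set (y := INR (N - i)) in *.
    apply Rminus_le.
    replace (/ x ^ 2 * / y ^ 2 - 2 * / (x + y) ^ 2 * (/ x ^ 2 + / y ^ 2))
      with (- ((x - y) ^ 2 / (x ^ 2 * y ^ 2 * (x + y) ^ 2))) by (field; nra).
    assert (0 <= (x - y) ^ 2 / (x ^ 2 * y ^ 2 * (x + y) ^ 2)); [|lra].
    apply Rdiv_le_0_compat; [apply pow2_ge_0|].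
    repeat apply Rmult_lt_0_compat; try apply pow_lt; lra.
  - rewrite lsum_scal, lsum_plus.
    pose proof (inv_sq_sum (S len) lo h1) as e1.
    pose proof (inv_sq_sum_rev N (S len) lo h2) as e2.
    assert (p : forall n, (1 <= n)%nat -> 0 <= / INR n <= 1).
    { intros n hn. pose proof (one_le_INR n hn). split.
      - apply Rlt_le, Rinv_0_lt_compat; lra.
      - rewrite <- Rinv_1. apply Rinv_le_contravar; lra. }
    pose proof (p lo h1). pose proof (p (lo + S len)%nat ltac:(lia)).
    pose proof (p (S (N - lo - S len)) ltac:(lia)). pose proof (p (S (N - lo)) ltac:(lia)).
    nra.
Qed.

(** These two sums are the norms of the products in [rest] and, with total index n + 1, in
    [mean_shift]. *)
Definition first_sum (U V : nat -> R) n :=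
  lsum (fun i => U i * V (n - i)%nat) (seq 1 (n - 1)).
Definition second_sum (U V : nat -> R) n :=
  lsum (fun i => U i * V (S n - i)%nat) (seq 2 (n - 2)).

(* The orders [n >= 2] are bounded with an extra factor [1/T]: this compensates for
   the total index [n + 1] of the second sum, in which order 1 does not occur. *)
Lemma majorant (U V : nat -> R) (c C : R) :
  1 <= c -> 0 <= C -> (forall n, 0 <= U n) -> (forall n, 0 <= V n) ->
  U 1%nat <= c -> V 1%nat <= c ->
  (forall n, (2 <= n)%nat -> U n <= C * (first_sum U V n + second_sum U V n)) ->
  (forall n, (2 <= n)%nat -> V n <= C * (first_sum U V n + second_sum U V n)) ->
  exists M, 1 <= M /\ forall n, (1 <= n)%nat -> U n <= c * M ^ n /\ V n <= c * M ^ n.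
Proof.
  intros hc hC hU0 hV0 hU1 hV1 hU hV.
  (* The 16 is twice the 8 of [inv_sq_convolution]. With [M = T ^ 2] the bound c T^-2 M^n / n^2
     equals c at n = 1, and the surplus M of the second sum is paid by T^-6 M^(n+1) = T^-4 M^n. Both
     sums are thus at most 8 c^2 T^-4 M^n / n^2, and T >= 16 C c^2 restores T^-3. *)
  set (T := 1 + 16 * C * c ^ 2).
  assert (hT : 1 <= T) by (unfold T; nra).
  assert (hT' : 16 * C * c ^ 2 <= T) by (unfold T; lra).
  clearbody T.
  set (M := T ^ 2). assert (hM : 1 <= M) by (unfold M; nra).
  assert (hw : forall n, (1 <= n)%nat -> 0 < inv_sq n <= 1).
  { intros n hn. pose proof (one_le_INR n hn). unfold inv_sq. split.
    - apply Rinv_0_lt_compat; nra.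
    - rewrite <- Rinv_1. apply Rinv_le_contravar; nra. }
  assert (hMn : forall n, 0 < M ^ n) by (intros; apply pow_lt; lra).
  assert (main : forall n, (1 <= n)%nat ->
     (U n <= c / T ^ 2 * M ^ n * inv_sq n /\ V n <= c / T ^ 2 * M ^ n * inv_sq n) /\
     ((2 <= n)%nat -> U n <= / T ^ 3 * M ^ n * inv_sq n /\ V n <= / T ^ 3 * M ^ n * inv_sq n)).
  { induction n as [n IH] using lt_wf_ind. intros hn.
    destruct (Nat.eq_dec n 1) as [->|hn1].
    { split; [|lia]. replace (c / T ^ 2 * M ^ 1 * inv_sq 1) with c; [lra|].
      unfold M, inv_sq. simpl. field. lra. }
    assert (hn2 : (2 <= n)%nat) by lia.
    pose proof (hMn n) as hMn'. pose proof (hw n hn) as hwn.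
    assert (h1 : first_sum U V n <= 8 * (c ^ 2 / T ^ 4 * M ^ n * inv_sq n)).
    { apply Rle_trans with (lsum (fun i => c ^ 2 / T ^ 4 * M ^ n * (inv_sq i * inv_sq (n - i)))
          (seq 1 (n - 1))).
      - apply lsum_le. intros i hi. apply in_seq in hi.
        destruct (IH i ltac:(lia) ltac:(lia)) as [[h _] _].
        destruct (IH (n - i)%nat ltac:(lia) ltac:(lia)) as [[_ h'] _].
        replace (M ^ n) with (M ^ i * M ^ (n - i)) by (rewrite <- pow_add; f_equal; lia).
        eapply Rle_trans; [apply Rmult_le_compat; [apply hU0|apply hV0|exact h|exact h']|].
        right. field. lra.
      - rewrite lsum_scal. pose proof (inv_sq_convolution n 1 (n - 1) ltac:(lia) ltac:(lia)).
        assert (0 < c ^ 2 / T ^ 4 * M ^ n).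
        { apply Rmult_lt_0_compat; [|assumption]. apply Rdiv_lt_0_compat; apply pow_lt; lra. }
        nra. }
    assert (h2 : second_sum U V n <= 8 * (/ T ^ 4 * M ^ n * inv_sq n)).
    { apply Rle_trans with (lsum (fun i => / T ^ 4 * M ^ n * (inv_sq i * inv_sq (S n - i))) (seq 2 (n - 2))).
      - apply lsum_le. intros i hi. apply in_seq in hi.
        destruct (IH i ltac:(lia) ltac:(lia)) as [_ h].
        destruct (IH (S n - i)%nat ltac:(lia) ltac:(lia)) as [_ h'].
        destruct (h ltac:(lia)) as [g _]. destruct (h' ltac:(lia)) as [_ g'].
        eapply Rle_trans; [apply Rmult_le_compat; [apply hU0|apply hV0|exact g|exact g']|].
        right. replace (/ T ^ 4 * M ^ n) with (/ T ^ 6 * M ^ (S n)).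
        + replace (M ^ S n) with (M ^ i * M ^ (S n - i)) by (rewrite <- pow_add; f_equal; lia).
          field. lra.
        + simpl. unfold M. field. lra.
      - rewrite lsum_scal.
        pose proof (inv_sq_convolution (S n) 2 (n - 2) ltac:(lia) ltac:(lia)).
        assert (inv_sq (S n) <= inv_sq n).
        { unfold inv_sq. pose proof (one_le_INR n hn). rewrite S_INR.
          apply Rinv_le_contravar; nra. }
        assert (0 < / T ^ 4 * M ^ n).
        { apply Rmult_lt_0_compat; [|assumption]. apply Rinv_0_lt_compat, pow_lt; lra. }
        nra. }
    assert (hX : C * (first_sum U V n + second_sum U V n) <= / T ^ 3 * M ^ n * inv_sq n).
    { apply Rle_trans with (16 * C * c ^ 2 * (/ T ^ 4 * M ^ n * inv_sq n)).
      - assert (0 < / T ^ 4 * M ^ n * inv_sq n).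
        { apply Rmult_lt_0_compat; [|lra]. apply Rmult_lt_0_compat; [|lra].
          apply Rinv_0_lt_compat, pow_lt; lra. }
        unfold Rdiv in h1. set (Y := / T ^ 4 * M ^ n * inv_sq n) in *.
        replace (c ^ 2 * / T ^ 4 * M ^ n * inv_sq n) with (c ^ 2 * Y) in h1 by (unfold Y; ring).
        replace (16 * C * c ^ 2 * Y) with (C * (8 * (c ^ 2 * Y) + 8 * (c ^ 2 * Y))) by ring.
        apply Rmult_le_compat_l; [assumption|]. assert (hc2 : 1 <= c ^ 2) by nra.
        pose proof (Rmult_le_compat_r Y 1 (c ^ 2) ltac:(lra) hc2). lra.
      - apply Rle_trans with (T * (/ T ^ 4 * M ^ n * inv_sq n)).
        + apply Rmult_le_compat_r; [|assumption].
          apply Rmult_le_pos; [|lra]. apply Rmult_le_pos; [|lra].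
          apply Rlt_le, Rinv_0_lt_compat, pow_lt; lra.
        + right. field. lra. }
    assert (hs : / T ^ 3 * M ^ n * inv_sq n <= c / T ^ 2 * M ^ n * inv_sq n).
    { apply Rmult_le_compat_r; [lra|]. apply Rmult_le_compat_r; [lra|].
      replace (/ T ^ 3) with (/ T * / T ^ 2) by (field; lra).
      apply Rmult_le_compat_r; [apply Rlt_le, Rinv_0_lt_compat, pow_lt; lra|].
      apply Rle_trans with 1; [|assumption]. rewrite <- Rinv_1. apply Rinv_le_contravar; lra. }
    
    specialize (hU n hn2). specialize (hV n hn2). repeat split; intros; lra. }
  exists M. split; [assumption|]. intros n hn.
  destruct (main n hn) as [h _]. pose proof (hMn n). pose proof (hw n hn).
  assert (hT2 : / T ^ 2 <= 1).
  { rewrite <- Rinv_1. apply Rinv_le_contravar; nra. }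
  assert (0 < / T ^ 2) by (apply Rinv_0_lt_compat, pow_lt; lra).
  assert (c / T ^ 2 * M ^ n * inv_sq n <= c * M ^ n); [|lra].
  replace (c / T ^ 2 * M ^ n * inv_sq n) with (c * M ^ n * (/ T ^ 2 * inv_sq n)) by (field; lra).
  rewrite <- (Rmult_1_r (c * M ^ n)) at 2. apply Rmult_le_compat_l.
  - apply Rlt_le, Rmult_lt_0_compat; lra.
  - rewrite <- (Rmult_1_l 1). apply Rmult_le_compat; lra.
Qed.

Lemma norm1_cross lo len N f :
  norm1 (cross lo len N f) =
  lsum (fun i => norm1 (fst (f i)) * norm1 (snd (f (N - i)%nat))) (seq lo len).
Proof.
  unfold cross. unfold norm1 at 1. rewrite lsum_flat_map.
  apply lsum_ext. intros i _. apply norm1_mul.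
Qed.

Lemma kernel_coef_bound g : Rabs (kernel_coef g) <= norm1 g.
Proof.
  rewrite <- (Rmult_1_l (norm1 g)). apply pairing_bound. intros _ jm _.
  destruct (is_kernel jm); rewrite Rabs_pos_eq; lra.
Qed.

Lemma coefficients_growth (a K : R) (mu : Z * Z -> R) (f : nat -> trigpoly * trigpoly) :
  0 < a -> (forall n, f n = next a mu n f) -> (forall jm, Rabs (mu jm) <= K) ->
  exists B M, 0 <= B /\ 1 <= M /\ forall n,
    norm1 (fst (f n)) <= B * M ^ n /\ norm1 (snd (f n)) <= B * M ^ n.
Proof.
  intros ha hf hmu.
  assert (hK : 0 <= K) by (eapply Rle_trans; [apply Rabs_pos|exact (hmu (0, 0)%Z)]).
  set (U := fun n => norm1 (fst (f n))). set (V := fun n => norm1 (snd (f n))).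
  assert (hia : 0 < / a) by now apply Rinv_0_lt_compat.
  assert (hia2 : 0 < / a ^ 2) by (apply Rinv_0_lt_compat, pow_lt; assumption).
  assert (hphi : norm1 phi = 1) by (unfold norm1, phi; simpl; rewrite Rabs_R1; lra).
  (* The part [multiplier mu r] counts twice: in u_n itself and in its mean value, where two
     products with [phi] enter with weight 1/2. *)
  set (C1 := (a ^ 2 + 2 * K) * / a + a ^ 2).
  assert (hC1 : 0 <= C1) by (unfold C1; nra).
  assert (hR : forall n, norm1 (rest a n f) = / a * first_sum U V n).
  { intros n. unfold rest. rewrite norm1_scale, norm1_cross, Rabs_Ropp, Rabs_pos_eq by lra.
    reflexivity. }
  assert (hpos1 : forall n, 0 <= first_sum U V n).
  { intros n. pose proof (norm1_nonneg (rest a n f)) as h. rewrite hR in h.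
    destruct (Rle_or_lt 0 (first_sum U V n)); nra. }
  assert (hpos2 : forall n, 0 <= second_sum U V n).
  { intros n. pose proof (norm1_nonneg (cross 2 (n - 2) (S n) f)) as h.
    rewrite norm1_cross in h. exact h. }
  assert (hU : forall n, (2 <= n)%nat -> U n <= C1 * (first_sum U V n + second_sum U V n)).
  { intros n hn. unfold U at 1. rewrite (u_ge2 a mu f hf n hn), norm1_app.
    pose proof (norm1_multiplier mu K (rest a n f) hmu) as hz.
    unfold norm1 at 1. simpl lsum. rewrite Rplus_0_r.
    assert (hs : Rabs (mean_shift a mu n f) <=
      a ^ 2 / 2 * (norm1 (rest a n f) + second_sum U V n)
      + norm1 (multiplier mu (rest a n f))).
    { unfold mean_shift. eapply Rle_trans; [apply Rabs_triang|].
      pose proof (kernel_coef_bound (mul phi (rest a n f))) as b1.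
      pose proof (kernel_coef_bound (cross 2 (n - 2) (S n) f)) as b2.
      pose proof (kernel_coef_bound (mul phi (multiplier mu (rest a n f)))) as b3.
      pose proof (kernel_coef_bound (mul (multiplier mu (rest a n f)) phi)) as b4.
      rewrite norm1_mul, hphi in b1, b3, b4. rewrite norm1_cross in b2.
      fold (second_sum U V n) in b2.
      rewrite Rabs_Ropp, !Rabs_mult, (Rabs_pos_eq (a ^ 2 / 2)), (Rabs_pos_eq (/ 2)) by nra.
      apply Rplus_le_compat.
      - apply Rmult_le_compat_l; [nra|]. eapply Rle_trans; [apply Rabs_triang|].
        change (second_sum U V n) with
          (lsum (fun i => norm1 (fst (f i)) * norm1 (snd (f (S n - i)%nat))) (seq 2 (n - 2))).
        lra.
      - eapply Rle_trans; [apply Rmult_le_compat_l; [lra|apply Rabs_triang]|]. lra. }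
    rewrite hR in hs, hz. pose proof (hpos1 n). pose proof (hpos2 n).
    set (F := first_sum U V n) in *. set (G := second_sum U V n) in *.
    assert (0 <= / a * F) by nra. unfold C1.
    assert (0 <= K * / a * F) by (apply Rmult_le_pos; nra).
    assert (0 <= a ^ 2 * (/ a * F)) by (apply Rmult_le_pos; nra).
    assert (0 <= ((a ^ 2 + 2 * K) * / a) * G) by (apply Rmult_le_pos; nra).
    assert (0 <= a ^ 2 * F) by (apply Rmult_le_pos; nra).
    nra. }
  destruct (majorant U V (1 + / a ^ 2) (C1 * (1 + / a ^ 2) + / a)) as (M & hM & h).
  - lra.
  - nra.
  - intros; apply norm1_nonneg.
  - intros; apply norm1_nonneg.
  - unfold U. rewrite (u_1 a mu f hf), hphi. lra.
  - unfold V. rewrite (v_1 a mu f hf), norm1_scale, hphi, Rabs_Ropp, Rabs_pos_eq; lra.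
  - intros n hn. eapply Rle_trans; [apply hU, hn|].
    apply Rmult_le_compat_r; [pose proof (hpos1 n); pose proof (hpos2 n); lra|].
    assert (0 <= C1 * / a ^ 2) by (apply Rmult_le_pos; lra). lra.
  - intros n hn. unfold V at 1. rewrite (v_ge1 a mu f hf) by lia.
    rewrite norm1_app, norm1_scale, hR, Rabs_Ropp, Rabs_pos_eq by lra.
    pose proof (hU n hn) as hUn. pose proof (hpos1 n). pose proof (hpos2 n).
    fold (U n).
    assert (/ a ^ 2 * U n <= / a ^ 2 * (C1 * (first_sum U V n + second_sum U V n)))
      by (apply Rmult_le_compat_l; lra).
    assert (0 <= C1 * (first_sum U V n + second_sum U V n)) by (apply Rmult_le_pos; lra).
    nra.
  - exists (1 + / a ^ 2 + a + / a), M. repeat split; try lra.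
    + destruct n as [|n].
      * rewrite (u_0 a mu f hf), pow_O. unfold norm1. simpl lsum.
        rewrite Rabs_pos_eq; lra.
      * destruct (h (S n) ltac:(lia)) as [h1 _]. pose proof (pow_lt M (S n) ltac:(lra)).
        eapply Rle_trans; [exact h1|]. apply Rmult_le_compat_r; lra.
    + destruct n as [|n].
      * rewrite (v_0 a mu f hf), pow_O. unfold norm1. simpl lsum.
        rewrite Rabs_pos_eq; lra.
      * destruct (h (S n) ltac:(lia)) as [_ h1]. pose proof (pow_lt M (S n) ltac:(lra)).
        eapply Rle_trans; [exact h1|]. apply Rmult_le_compat_r; lra.
Qed.

(** * Termwise differentiation *)

Lemma ex_series_half (x : nat -> R) (A : R) :
  (forall n, Rabs (x n) <= A * (/ 2) ^ n) -> ex_series (fun n => Rabs (x n)).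
Proof.
  intros h. apply (ex_series_le (K := R_AbsRing) (V := R_CompleteNormedModule) _ (fun n => A * (/ 2) ^ n)).
  - intros n. unfold norm; simpl. unfold abs; simpl. rewrite Rabs_Rabsolu. apply h.
  - apply (ex_series_scal (K := R_AbsRing) (V := R_NormedModule)), ex_series_geom.
    rewrite Rabs_pos_eq; lra.
Qed.

Lemma Series_half_bound (x : nat -> R) (A : R) :
  (forall n, Rabs (x n) <= A * (/ 2) ^ n) -> Rabs (Series x) <= 2 * A.
Proof.
  intros h. eapply Rle_trans; [apply Series_Rabs; eapply ex_series_half; eassumption|].
  eapply Rle_trans.
  - apply Series_le with (b := fun n => A * (/ 2) ^ n).
    + intros n; split; [apply Rabs_pos|apply h].
    + apply (ex_series_scal (K := R_AbsRing) (V := R_NormedModule)), ex_series_geom.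
      rewrite Rabs_pos_eq; lra.
  - rewrite Series_scal_l, Series_geom by (rewrite Rabs_pos_eq; lra). lra.
Qed.

Lemma is_derive_MVT (f df : R -> R) (x y : R) :
  (forall z, is_derive f z (df z)) ->
  exists c, Rabs (c - x) <= Rabs (y - x) /\ f y - f x = df c * (y - x).
Proof.
  intros h. destruct (MVT_gen f x y df) as (c & hc & e).
  - intros; apply h.
  - intros z _. apply continuity_pt_filterlim.
    apply (ex_derive_continuous (K := R_AbsRing) (V := R_NormedModule)). exists (df z). apply h.
  - exists c. split; [|exact e].
    unfold Rmin, Rmax in hc.
    destruct (Rle_dec x y); unfold Rabs; repeat destruct Rcase_abs; lra.
Qed.

Lemma Series_lipschitz (F F' : nat -> R -> R) (A : R) :
  (forall n z, is_derive (F n) z (F' n z)) ->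
  (forall n z, Rabs (F n z) <= A * (/ 2) ^ n) ->
  (forall n z, Rabs (F' n z) <= A * (/ 2) ^ n) ->
  forall x y, Rabs (Series (fun n => F n y) - Series (fun n => F n x)) <= 2 * A * Rabs (y - x).
Proof.
  intros hd h0 h1 x y.
  assert (e : forall z, ex_series (fun n => F n z)).
  { intros z. apply ex_series_Rabs. now apply (ex_series_half _ A). }
  rewrite <- Series_minus by apply e. rewrite Rmult_assoc.
  apply Series_half_bound. intros n.
  destruct (is_derive_MVT (F n) (F' n) x y (hd n)) as (c & _ & ->).
  rewrite Rabs_mult. pose proof (h1 n c). pose proof (Rabs_pos (y - x)). nra.
Qed.

(** Bounds on second derivatives replace uniform convergence: two uses of the mean value theorem
    bound the first-order Taylor remainder of each term by A 2^-n (y - x)^2, and these sum to 2 A (y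
    - x)^2. *)
Lemma is_derive_Series (F F' F'' : nat -> R -> R) (A x : R) :
  (forall n z, is_derive (F n) z (F' n z)) ->
  (forall n z, is_derive (F' n) z (F'' n z)) ->
  (forall n z, Rabs (F n z) <= A * (/ 2) ^ n) ->
  (forall n z, Rabs (F' n z) <= A * (/ 2) ^ n) ->
  (forall n z, Rabs (F'' n z) <= A * (/ 2) ^ n) ->
  is_derive (fun z => Series (fun n => F n z)) x (Series (fun n => F' n x)).
Proof.
  intros hd hd' h0 h1 h2.
  assert (hA : 0 <= A).
  { pose proof (h0 O 0). pose proof (Rabs_pos (F O 0)). simpl in *. lra. }
  assert (e : forall z, ex_series (fun n => F n z)).
  { intros z. apply ex_series_Rabs. now apply (ex_series_half _ A). }
  assert (e' : ex_series (fun n => F' n x)).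
  { apply ex_series_Rabs. now apply (ex_series_half _ A). }
  assert (key : forall y, Rabs (Series (fun n => F n y) - Series (fun n => F n x)
     - (y - x) * Series (fun n => F' n x)) <= 2 * (A * (y - x) ^ 2)).
  { intros y. rewrite <- Series_scal_l, <- Series_minus by apply e.
    rewrite <- Series_minus.
    - apply Series_half_bound. intros n.
      destruct (is_derive_MVT (F n) (F' n) x y (hd n)) as (c & hc & ->).
      replace (F' n c * (y - x) - (y - x) * F' n x) with ((F' n c - F' n x) * (y - x)) by ring.
      destruct (is_derive_MVT (F' n) (F'' n) x c (hd' n)) as (d & _ & ->).
      rewrite !Rabs_mult, <- pow2_abs. pose proof (h2 n d).
      pose proof (Rabs_pos (y - x)). pose proof (Rabs_pos (c - x)).
      pose proof (Rabs_pos (F'' n d)).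
      apply Rle_trans with ((A * (/ 2) ^ n) * Rabs (y - x) * Rabs (y - x)); [|lra].
      apply Rmult_le_compat_r; [assumption|].
      apply Rmult_le_compat; assumption.
    - apply (ex_series_minus (K := R_AbsRing) (V := R_NormedModule)); apply e.
    - now apply (ex_series_scal (K := R_AbsRing) (V := R_NormedModule)). }
  apply is_derive_Reals. intros eps heps.
  assert (hdelta : 0 < eps / (2 * A + 1)) by (apply Rdiv_lt_0_compat; lra).
  exists (mkposreal _ hdelta). intros h hne hh. simpl in hh.
  specialize (key (x + h)). replace (x + h - x) with h in key by ring.
  set (D := Series (fun n => F n (x + h)) - Series (fun n => F n x)) in *.
  set (L := Series (fun n => F' n x)) in *.
  assert (hp : 0 < Rabs h) by now apply Rabs_pos_lt.
  replace (D / h - L) with ((D - h * L) / h) by (field; assumption).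
  unfold Rdiv. rewrite Rabs_mult, Rabs_inv.
  apply Rmult_lt_reg_r with (Rabs h); [assumption|].
  rewrite Rmult_assoc, Rinv_l, Rmult_1_r by lra.
  rewrite <- pow2_abs in key. eapply Rle_lt_trans; [exact key|].
  assert ((2 * A + 1) * Rabs h < eps).
  { rewrite Rmult_comm. now apply Rlt_div_r; [lra|]. }
  nra.
Qed.

(** * Weighted sums of a family of smooth functions *)

Section Family.

(* [g i l n] is the derivative of order [i] in t and [l] in s of [g 0 0 n]. *)
Context (g : nat -> nat -> nat -> R -> R -> R) (K : nat -> nat -> R) (r rho : R).
Hypothesis hdt : forall i l n t s, is_derive (fun x => g i l n x s) t (g (S i) l n t s).
Hypothesis hds : forall i l n t s, is_derive (fun y => g i l n t y) s (g i (S l) n t s).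
Hypothesis hg : forall i l n t s, Rabs (g i l n t s) <= K i l * rho ^ n.
Hypothesis hrho : r * rho = / 2.

(** The weights stay general since three choices occur: b^n for the solution, b'^n - b^n for
    continuity in b, and b^n without orders 0 and 1 for the O(b^2) remainder. One norm bound, linear
    in the constant [E] of [dominated], serves all three. *)
Definition fsum (be : nat -> R) (i l : nat) (t s : R) : R :=
  Series (fun n => be n * g i l n t s).

Definition dominated (be : nat -> R) (E : R) : Prop :=
  forall n, Rabs (be n) <= E * r ^ n.

Lemma K_nonneg i l : 0 <= K i l.
Proof. pose proof (hg i l O 0 0). pose proof (Rabs_pos (g i l O 0 0)). simpl in *. lra. Qed.

Lemma dominated_nonneg be E : dominated be E -> 0 <= E.
Proof. intros h. pose proof (h O). pose proof (Rabs_pos (be O)). simpl in *. lra. Qed.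

Lemma term_bound be E i l n t s : dominated be E ->
  Rabs (be n * g i l n t s) <= E * K i l * (/ 2) ^ n.
Proof.
  intros h. rewrite Rabs_mult, <- hrho, Rpow_mult_distr.
  replace (E * K i l * (r ^ n * rho ^ n)) with ((E * r ^ n) * (K i l * rho ^ n)) by ring.
  apply Rmult_le_compat; auto using Rabs_pos.
Qed.

Lemma ex_series_fsum_abs be E i l t s : dominated be E ->
  ex_series (fun n => Rabs (be n * g i l n t s)).
Proof. intros h. apply (ex_series_half _ (E * K i l)). intros; now apply term_bound. Qed.

Lemma ex_series_fsum be E i l t s : dominated be E ->
  ex_series (fun n => be n * g i l n t s).
Proof. intros h. eapply ex_series_Rabs, ex_series_fsum_abs, h. Qed.

Lemma fsum_bound be E i l t s : dominated be E -> Rabs (fsum be i l t s) <= E * (2 * K i l).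
Proof.
  intros h. replace (E * (2 * K i l)) with (2 * (E * K i l)) by ring.
  apply Series_half_bound. intros; now apply term_bound.
Qed.

(** [is_derive_Series] and [Series_lipschitz] want one constant for several derivatives at once; the
    sum of the individual constants provides it. *)
Lemma term_bound_max be E i l i' l' i'' l'' n t s : dominated be E ->
  (i = i' /\ l = l' \/ i = S i' /\ l = l' \/ i = i' /\ l = S l'
   \/ i = i'' /\ l = l'') ->
  Rabs (be n * g i l n t s) <=
    E * (K i' l' + K (S i') l' + K i' (S l') + K i'' l'') * (/ 2) ^ n.
Proof.
  intros h hi. eapply Rle_trans; [apply term_bound, h|].
  apply Rmult_le_compat_r; [apply pow_le; lra|].
  apply Rmult_le_compat_l; [now apply (dominated_nonneg be)|].
  pose proof (K_nonneg i' l'). pose proof (K_nonneg (S i') l').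
  pose proof (K_nonneg i' (S l')). pose proof (K_nonneg i'' l'').
  destruct hi as [[-> ->]|[[-> ->]|[[-> ->]|[-> ->]]]]; lra.
Qed.

Lemma is_derive_fsum_t be E i l t s : dominated be E ->
  is_derive (fun x => fsum be i l x s) t (fsum be (S i) l t s).
Proof.
  intros h.
  apply (is_derive_Series (fun n x => be n * g i l n x s)
    (fun n x => be n * g (S i) l n x s) (fun n x => be n * g (S (S i)) l n x s)
    (E * (K i l + K (S i) l + K i (S l) + K (S (S i)) l))).
  - intros n z. apply is_derive_scal, hdt.
  - intros n z. apply is_derive_scal, hdt.
  - intros n z. apply term_bound_max; tauto.
  - intros n z. apply term_bound_max; tauto.
  - intros n z. apply term_bound_max; tauto.
Qed.

Lemma is_derive_fsum_s be E i l t s : dominated be E ->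
  is_derive (fun y => fsum be i l t y) s (fsum be i (S l) t s).
Proof.
  intros h.
  apply (is_derive_Series (fun n y => be n * g i l n t y)
    (fun n y => be n * g i (S l) n t y) (fun n y => be n * g i (S (S l)) n t y)
    (E * (K i l + K (S i) l + K i (S l) + K i (S (S l))))).
  - intros n z. apply is_derive_scal, hds.
  - intros n z. apply is_derive_scal, hds.
  - intros n z. apply term_bound_max; tauto.
  - intros n z. apply term_bound_max; tauto.
  - intros n z. apply term_bound_max; tauto.
Qed.

Lemma fsum_lipschitz be E i l : dominated be E -> exists A, 0 <= A /\
  forall t s t' s', Rabs (fsum be i l t' s' - fsum be i l t s)
    <= A * (Rabs (t' - t) + Rabs (s' - s)).
Proof.
  intros h. exists (2 * (E * (K i l + K (S i) l + K i (S l) + K i l))). split.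
  { pose proof (dominated_nonneg be E h).
    pose proof (K_nonneg i l). pose proof (K_nonneg (S i) l). pose proof (K_nonneg i (S l)).
    apply Rmult_le_pos; [lra|]. apply Rmult_le_pos; lra. }
  intros t s t' s'.
  replace (fsum be i l t' s' - fsum be i l t s) with
    ((fsum be i l t' s' - fsum be i l t s') + (fsum be i l t s' - fsum be i l t s)) by ring.
  eapply Rle_trans; [apply Rabs_triang|]. rewrite Rmult_plus_distr_l.
  apply Rplus_le_compat.
  - apply (Series_lipschitz (fun n x => be n * g i l n x s') (fun n x => be n * g (S i) l n x s')).
    + intros n z. apply is_derive_scal, hdt.
    + intros n z. apply term_bound_max; tauto.
    + intros n z. apply term_bound_max; tauto.
  - apply (Series_lipschitz (fun n y => be n * g i l n t y) (fun n y => be n * g i (S l) n t y)).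
    + intros n z. apply is_derive_scal, hds.
    + intros n z. apply term_bound_max; tauto.
    + intros n z. apply term_bound_max; tauto.
Qed.

Lemma jointly_continuous_fsum be E i l : dominated be E ->
  jointly_continuous (fun t s => RtoC (fsum be i l t s)).
Proof.
  intros h [t s]. destruct (fsum_lipschitz be E i l h) as (A & hA & hl).
  apply filterlim_locally. intros eps.
  assert (hd : 0 < eps / (2 * A + 1)).
  { apply Rdiv_lt_0_compat; [apply cond_pos|lra]. }
  exists (mkposreal _ hd). intros [t' s'] [h1 h2]. simpl in h1, h2 |- *.
  assert (h1' : Rabs (t' - t) < eps / (2 * A + 1)) by exact h1.
  assert (h2' : Rabs (s' - s) < eps / (2 * A + 1)) by exact h2.
  split; simpl.
  - change (Rabs (fsum be i l t' s' - fsum be i l t s) < eps).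
    eapply Rle_lt_trans; [apply hl|].
    apply Rlt_div_r in h1'; [|lra]. apply Rlt_div_r in h2'; [|lra].
    pose proof (cond_pos eps).
    pose proof (Rabs_pos (t' - t)). pose proof (Rabs_pos (s' - s)). nra.
  - change (Rabs (0 - 0) < eps). rewrite Rminus_0_r, Rabs_R0. apply cond_pos.
Qed.

Lemma Dt_RtoC (f : R -> R -> R) :
  Dt (fun t s => RtoC (f t s)) = (fun t s => RtoC (Derive (fun x => f x s) t)).
Proof.
  do 2 (apply functional_extensionality; intro). unfold Dt, RtoC. simpl.
  f_equal. apply Derive_const.
Qed.

Lemma Ds_RtoC (f : R -> R -> R) :
  Ds (fun t s => RtoC (f t s)) = (fun t s => RtoC (Derive (fun y => f t y) s)).
Proof.
  do 2 (apply functional_extensionality; intro). unfold Ds, RtoC. simpl.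
  f_equal. apply Derive_const.
Qed.

Lemma Dt_fsum be E i l : dominated be E ->
  Dt (fun t s => RtoC (fsum be i l t s)) = (fun t s => RtoC (fsum be (S i) l t s)).
Proof.
  intros h. rewrite Dt_RtoC. do 2 (apply functional_extensionality; intro).
  f_equal. apply is_derive_unique. now apply (is_derive_fsum_t be E).
Qed.

Lemma Ds_fsum be E i l : dominated be E ->
  Ds (fun t s => RtoC (fsum be i l t s)) = (fun t s => RtoC (fsum be i (S l) t s)).
Proof.
  intros h. rewrite Ds_RtoC. do 2 (apply functional_extensionality; intro).
  f_equal. apply is_derive_unique. now apply (is_derive_fsum_s be E).
Qed.

Lemma iter_Dt_fsum be E m i l : dominated be E ->
  Nat.iter m Dt (fun t s => RtoC (fsum be i l t s)) = (fun t s => RtoC (fsum be (m + i) l t s)).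
Proof. intros h. induction m; simpl; [reflexivity|]. now rewrite IHm, (Dt_fsum be E). Qed.

Lemma iter_Ds_fsum be E m i l : dominated be E ->
  Nat.iter m Ds (fun t s => RtoC (fsum be i l t s)) = (fun t s => RtoC (fsum be i (m + l) t s)).
Proof. intros h. induction m; simpl; [reflexivity|]. now rewrite IHm, (Ds_fsum be E). Qed.

Lemma ex_derive_RtoC (f : R -> R) x : ex_derive f x ->
  ex_derive (V := C_R_NormedModule) (fun x => RtoC (f x)) x.
Proof.
  intros [d hd].
  apply ex_derive_ext with (f := fun x => scal (V := C_R_NormedModule) (f x) (RtoC 1)).
  - intros y. unfold RtoC, scal; simpl. unfold prod_scal, scal; simpl.
    unfold mult; simpl. f_equal; ring.
  - eexists. apply (is_derive_scal_l (K := R_AbsRing) (V := C_R_NormedModule)). exact hd.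
Qed.

Lemma is_Cn_fsum be E m : dominated be E ->
  forall i l, is_Cn m (fun t s => RtoC (fsum be i l t s)).
Proof.
  intros h. induction m as [|m IH]; intros i l.
  - split; [now apply (jointly_continuous_fsum be E)|exact I].
  - split; [now apply (jointly_continuous_fsum be E)|]. split; [|split].
    + intros t s. split; apply ex_derive_RtoC; eexists.
      * now apply (is_derive_fsum_t be E).
      * now apply (is_derive_fsum_s be E).
    + rewrite (Dt_fsum be E) by assumption. apply IH.
    + rewrite (Ds_fsum be E) by assumption. apply IH.
Qed.

Lemma Cn_norm_le_fsum m : exists C, 0 <= C /\ forall be E, dominated be E ->
  Cn_norm_le m (fun t s => RtoC (fsum be 0 0 t s)) (E * C).
Proof.
  set (C := lsum (fun i => lsum (fun l => 2 * K i l) (seq 0 (S m))) (seq 0 (S m))).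
  assert (hin : forall (A : Type) (F : A -> R) x l, (forall y, 0 <= F y) -> In x l ->
     0 <= F x <= lsum F l).
  { intros A F x l hF. assert (hp : forall l, 0 <= lsum F l).
    { induction l0; simpl; [lra|]. pose proof (hF a). lra. }
    induction l; simpl; [tauto|]. pose proof (hp l). pose proof (hF a).
    intros [->|hx]; [lra|]. specialize (IHl hx). lra. }
  assert (hpos : forall l i, 0 <= lsum (fun l => 2 * K i l) l).
  { intros l i. induction l; simpl; [lra|]. pose proof (K_nonneg i a). lra. }
  assert (hC : forall i j, (i + j <= m)%nat -> 0 <= 2 * K i j <= C).
  { intros i j hij.
    pose proof (hin _ (fun l => 2 * K i l) j (seq 0 (S m))
      ltac:(intros y; pose proof (K_nonneg i y); lra) ltac:(apply in_seq; lia)).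
    pose proof (hin _ (fun i => lsum (fun l => 2 * K i l) (seq 0 (S m))) i (seq 0 (S m))
      ltac:(intros y; apply hpos) ltac:(apply in_seq; lia)).
    unfold C. lra. }
  exists C. split; [apply Rle_trans with (2 * K 0 0); apply hC; lia|].
  intros be E h. split; [now apply (is_Cn_fsum be E)|].
  intros i j hij t s.
  rewrite (iter_Ds_fsum be E), (iter_Dt_fsum be E) by assumption.
  rewrite Cmod_R, !Nat.add_0_r. eapply Rle_trans; [apply fsum_bound, h|].
  apply Rmult_le_compat_l; [now apply (dominated_nonneg be)|]. now apply hC.
Qed.

End Family.

(** * Modes and the resolvent *)

Lemma exp_INR_mult n x : exp (INR n * x) = exp x ^ n.
Proof.
  induction n; [simpl; rewrite Rmult_0_l; apply exp_0|].
  rewrite S_INR, Rmult_plus_distr_r, Rmult_1_l, exp_plus, IHn. simpl. ring.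
Qed.

(** A derivative of order d costs n^d on degree n. Absorbing it into 3^n, with a base independent of
    d, gives all derivatives a common radius of convergence. For y = n/(d + 1) one has y^d <=
    exp(y)^(d+1) = exp(n). *)
Lemma pow_le_exponential n d : INR n ^ d <= INR (S d) ^ d * 3 ^ n.
Proof.
  assert (hD : 0 < INR (S d)) by (apply lt_0_INR; lia).
  assert (hn : 0 <= INR n) by apply pos_INR.
  set (y := INR n / INR (S d)).
  assert (hy : 0 <= y) by (apply Rdiv_le_0_compat; lra).
  replace (INR n) with (INR (S d) * y) by (unfold y; field; lra).
  rewrite Rpow_mult_distr. apply Rmult_le_compat_l; [apply pow_le; lra|].
  apply Rle_trans with (exp y ^ S d).
  - assert (he : 1 + y <= exp y) by apply exp_ineq1_le.
    apply Rle_trans with (exp y ^ d); [apply pow_incr; lra|].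
    apply Rle_pow; [lra|lia].
  - rewrite <- exp_INR_mult. replace (INR (S d) * y) with (INR n * 1) by (unfold y; field; lra).
    rewrite exp_INR_mult. apply pow_incr. split; [left; apply exp_pos|apply exp_le_3].
Qed.

Lemma cos_quarter_S x i : cos (x + INR (S i) * (PI / 2)) = - sin (x + INR i * (PI / 2)).
Proof.
  rewrite S_INR. replace (x + (INR i + 1) * (PI / 2)) with (PI / 2 + (x + INR i * (PI / 2))) by ring.
  symmetry. rewrite sin_cos. ring.
Qed.

Lemma is_derive_dmode_t nu k i l t s jm :
  is_derive (fun x => dmode nu k i l x s jm) t (dmode nu k (S i) l t s jm).
Proof.
  unfold dmode. rewrite cos_quarter_S.
  auto_derive; [exact I|]. simpl. ring.
Qed.

Lemma is_derive_dmode_s nu k i l t s jm :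
  is_derive (fun y => dmode nu k i l t y jm) s (dmode nu k i (S l) t s jm).
Proof.
  unfold dmode. rewrite cos_quarter_S.
  auto_derive; [exact I|]. simpl. ring.
Qed.

Lemma is_derive_pairing (chi : R -> Z * Z -> R) (dchi : Z * Z -> R) x f :
  (forall jm, is_derive (fun y => chi y jm) x (dchi jm)) ->
  is_derive (fun y => pairing (chi y) f) x (pairing dchi f).
Proof.
  intros h. induction f as [|[c jm] f IH]; unfold pairing; simpl.
  - apply (is_derive_const (K := R_AbsRing) (V := R_NormedModule)).
  - apply (is_derive_plus (K := R_AbsRing) (V := R_NormedModule)); [|exact IH].
    apply is_derive_scal, h.
Qed.

Lemma dmode_bound nu k i l t s j m n : 0 <= nu -> 0 <= k ->
  (Z.abs j <= Z.of_nat n)%Z -> (Z.abs m <= Z.of_nat n)%Z ->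
  Rabs (dmode nu k i l t s (j, m)) <= nu ^ i * k ^ l * INR n ^ (i + l).
Proof.
  intros hnu hk hj hm. unfold dmode. cbn [fst snd].
  assert (p : forall z c e, 0 <= c -> (Z.abs z <= Z.of_nat n)%Z ->
     Rabs ((IZR z * c) ^ e) <= (INR n * c) ^ e).
  { intros z c e hc hz. rewrite <- RPow_abs. apply pow_incr. split; [apply Rabs_pos|].
    rewrite Rabs_mult, (Rabs_pos_eq c) by assumption.
    apply Rmult_le_compat_r; [assumption|].
    rewrite <- abs_IZR, INR_IZR_INZ. now apply IZR_le. }
  assert (cb : forall x, Rabs (cos x) <= 1).
  { intros x. apply Rabs_le. pose proof (COS_bound x). lra. }
  rewrite !Rabs_mult.
  apply Rle_trans with ((INR n * nu) ^ i * (INR n * k) ^ l * (1 * 1)).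
  - repeat apply Rmult_le_compat; auto using Rabs_pos;
      apply Rmult_le_pos; apply Rabs_pos.
  - right. rewrite !Rpow_mult_distr, pow_add. ring.
Qed.

Lemma cos_periodZ x j : cos (x + IZR j * (2 * PI)) = cos x.
Proof.
  destruct (Z.le_ge_cases 0 j) as [h|h].
  - replace (x + IZR j * (2 * PI)) with (x + 2 * INR (Z.to_nat j) * PI); [apply cos_period|].
    rewrite INR_IZR_INZ, Z2Nat.id by assumption. ring.
  - rewrite <- (cos_period (x + IZR j * (2 * PI)) (Z.to_nat (- j))).
    f_equal. rewrite INR_IZR_INZ, Z2Nat.id, opp_IZR by lia. ring.
Qed.

Lemma mode_periodic_l x y jm : mode (x + 2 * PI) y jm = mode x y jm.
Proof. unfold mode. rewrite Rmult_plus_distr_l, cos_periodZ. reflexivity. Qed.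

Lemma mode_periodic_r x y jm : mode x (y + 2 * PI) jm = mode x y jm.
Proof. unfold mode. rewrite (Rmult_plus_distr_l _ y), cos_periodZ. reflexivity. Qed.

Lemma mode_opp_l x y jm : mode (- x) y jm = mode x y jm.
Proof. unfold mode. rewrite Ropp_mult_distr_r_reverse, cos_neg. reflexivity. Qed.

Lemma mode_opp_r x y jm : mode x (- y) jm = mode x y jm.
Proof. unfold mode. rewrite (Ropp_mult_distr_r_reverse _ y), cos_neg. reflexivity. Qed.

(** p = 0 happens only for q = k0 = 1. Then nu = 0, lambda does not depend on j, and the zero at (1,
    k0, 0) entails another one at (2, k0, 0). *)
Lemma nonresonant_freq_pos q k0 a0 : (0 < q)%nat -> (0 < k0)%nat ->
  nonresonant (freq_nu q k0) a0 1 k0 0 -> (0 < freq_p q k0)%Z.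
Proof.
  intros hq hk hn. destruct (Z.eq_dec (freq_p q k0) 0) as [e|e].
  - exfalso. unfold nonresonant in hn.
    assert (hnu : freq_nu q k0 = 0) by (unfold freq_nu, Rdiv; rewrite e; ring).
    destruct (proj2 (hn 1%Z (Z.of_nat k0) 0%nat) ltac:(lia)) as [(_ & _ & h0) (_ & h2 & _)].
    destruct (proj1 (hn 2%Z (Z.of_nat k0) 0%nat)) as [h _]; [|lia].
    repeat split; try (now left); try (now exists 2%Z); try assumption.
    + intros E. injection E; lia.
    + rewrite <- h0. unfold lambda. rewrite hnu. ring.
  - unfold freq_p in *. nia.
Qed.

Lemma symbol_lambda a nu k0 j m :
  symbol a nu (INR k0) (j, m) = lambda nu a j (Z.of_nat k0 * m) 0.
Proof.
  unfold symbol, lambda. cbn [fst snd].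
  rewrite mult_IZR, <- INR_IZR_INZ. simpl. ring.
Qed.

(** L^-1 d_ss mode by mode. The value 0 on kernel modes keeps the (1, 1) mode out of all orders n >=
    2; at the origin the numerator vanishes and the quotient is 0 as well. *)
Definition resolvent (a nu k : R) (jm : Z * Z) : R :=
  if is_kernel jm then 0 else (IZR (snd jm) * k) ^ 2 / symbol a nu k jm.

Section Resolvent.

Context (q k0 : nat) (a0 : R).
Hypothesis hq : (0 < q)%nat.
Hypothesis hk : (0 < k0)%nat.
Hypothesis ha : is_amplitude q k0 a0.
Hypothesis hn : nonresonant (freq_nu q k0) a0 1 k0 0.

Lemma symbol_zero jm : symbol a0 (freq_nu q k0) (INR k0) jm = 0 ->
  jm = (0%Z, 0%Z) \/ is_kernel jm = true.
Proof.
  destruct jm as [j m]. rewrite symbol_lambda. intros h.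
  destruct (Z.eq_dec j 0) as [hj|hj]; [destruct (Z.eq_dec m 0) as [hm|hm]|];
    [left; congruence|right|right].
  all: destruct (proj1 (hn j (Z.of_nat k0 * m)%Z 0%nat)) as (h1 & h2 & _);
    [split; [split; [intros E; injection E; nia|auto]
            |repeat split; [now exists j; lia|now exists m; lia|now left]]|].
  all: assert (m = 1 \/ m = -1)%Z by nia.
  all: unfold is_kernel; cbn [fst snd]; apply andb_true_intro; split; apply Z.eqb_eq; lia.
Qed.

Lemma symbol_one : symbol a0 (freq_nu q k0) (INR k0) (1, 1)%Z = 0.
Proof.
  rewrite symbol_lambda. apply (hn 1%Z (Z.of_nat k0 * 1)%Z 0%nat). lia.
Qed.

Lemma resolvent_symbol jm :
  resolvent a0 (freq_nu q k0) (INR k0) jm * symbol a0 (freq_nu q k0) (INR k0) jm =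
  if is_kernel jm then 0 else (IZR (snd jm) * INR k0) ^ 2.
Proof.
  unfold resolvent. destruct (is_kernel jm) eqn:e; [ring|].
  destruct (Req_dec (symbol a0 (freq_nu q k0) (INR k0) jm) 0) as [h|h].
  - rewrite h. destruct (symbol_zero jm h) as [->|h']; [simpl; ring|congruence].
  - field. exact h.
Qed.

(** The integer bound q^2 |lambda| >= 3 m^2 / 4 cancels the m^2 of the numerator, leaving a constant
    independent of the mode. *)
Lemma resolvent_bound jm :
  Rabs (resolvent a0 (freq_nu q k0) (INR k0) jm) <= 4 / 3 * (INR q ^ 2 * INR k0 ^ 2).
Proof.
  assert (hq' : 0 < INR q) by (apply lt_0_INR; lia).
  assert (hK : 0 <= 4 / 3 * (INR q ^ 2 * INR k0 ^ 2)).
  { assert (0 <= INR q ^ 2 * INR k0 ^ 2); [|lra].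
    apply Rmult_le_pos; apply pow2_ge_0. }
  unfold resolvent. destruct (is_kernel jm) eqn:e; [rewrite Rabs_R0; exact hK|].
  destruct (Req_dec (symbol a0 (freq_nu q k0) (INR k0) jm) 0) as [h|h].
  - destruct (symbol_zero jm h) as [->|h']; [|congruence].
    simpl. replace (_ / _) with 0 by (unfold Rdiv; simpl; ring). rewrite Rabs_R0; exact hK.
  - destruct jm as [j m]. cbn [snd]. rewrite symbol_lambda in *.
    set (L := lambda _ _ _ _ _) in *.
    pose proof (amplitude_lambda q k0 a0 j m 0 hq hk ha) as el. fold L in el.
    change ((-1) ^ Z.of_nat 0)%Z with 1%Z in el.
    set (S := scaled_lambda _ _ _ _) in el.
    assert (hS : (3 * m ^ 2 <= 4 * Z.abs S)%Z).
    { apply scaled_lambda_lower; [nia|]. intros e0. fold S in e0. rewrite e0 in el.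
      apply Rmult_integral in el as [el|el]; [|contradiction].
      assert (0 < INR q ^ 2) by (apply pow_lt; assumption). lra. }
    apply IZR_le in hS. rewrite !mult_IZR, abs_IZR, <- el, Rabs_mult in hS.
    rewrite (Rabs_pos_eq (INR q ^ 2)) in hS by apply pow2_ge_0.
    rewrite Z.pow_2_r, mult_IZR in hS.
    unfold Rdiv. rewrite Rabs_mult, Rabs_inv, (Rabs_pos_eq ((IZR m * INR k0) ^ 2)) by apply pow2_ge_0.
    assert (hL : 0 < Rabs L) by now apply Rabs_pos_lt.
    apply Rmult_le_reg_r with (Rabs L); [assumption|].
    rewrite Rmult_assoc, Rinv_l, Rmult_1_r by lra.
    assert (0 <= INR k0 ^ 2) by apply pow2_ge_0.
    rewrite Rpow_mult_distr. nra.
Qed.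

End Resolvent.

(** * The branch of solutions *)

Lemma Cn_norm_le_weaken n f K K' : Cn_norm_le n f K -> K <= K' -> Cn_norm_le n f K'.
Proof. intros [h1 h2] h. split; [exact h1|]. intros. eapply Rle_trans; eauto. Qed.

Lemma dominated_pow r b : 0 <= b <= r -> dominated r (fun n => b ^ n) 1.
Proof.
  intros h n. rewrite Rabs_pos_eq by (apply pow_le; lra).
  rewrite Rmult_1_l. now apply pow_incr.
Qed.

(** The mean value bound n c^(n-1) |b' - b|, multiplied by c to avoid the exponent n - 1. *)
Lemma pow_diff_bound b b' c n : 0 <= b <= c -> 0 <= b' <= c ->
  c * Rabs (b' ^ n - b ^ n) <= Rabs (b' - b) * (INR n * c ^ n).
Proof.
  intros h h'. induction n as [|n IH].
  { simpl. rewrite Rminus_diag, Rabs_R0. lra. }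
  replace (b' ^ S n - b ^ S n) with (b' * (b' ^ n - b ^ n) + b ^ n * (b' - b)) by (simpl; ring).
  assert (hb : 0 <= b ^ n <= c ^ n) by (split; [apply pow_le|apply pow_incr]; lra).
  pose proof (Rabs_pos (b' - b)). pose proof (Rabs_pos (b' ^ n - b ^ n)).
  apply Rle_trans with (c * (c * Rabs (b' ^ n - b ^ n) + c ^ n * Rabs (b' - b))).
  - apply Rmult_le_compat_l; [lra|]. eapply Rle_trans; [apply Rabs_triang|].
    rewrite !Rabs_mult, (Rabs_pos_eq b'), (Rabs_pos_eq (b ^ n)) by lra.
    apply Rplus_le_compat; apply Rmult_le_compat_r; lra.
  - rewrite S_INR. simpl.
    apply Rmult_le_compat_l with (r := c) in IH; [|lra]. lra.
Qed.

(** Keeping b in [0, r/2] leaves a factor 2^n in hand, which absorbs the n produced by the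
    difference of powers. *)
Lemma dominated_pow_diff r b b' : 0 < r -> 0 <= b <= r / 2 -> 0 <= b' <= r / 2 ->
  dominated r (fun n => b' ^ n - b ^ n) (Rabs (b' - b) / (r / 2)).
Proof.
  intros hr h h' n.
  pose proof (pow_diff_bound b b' (r / 2) n h h') as hp.
  assert (h2 : INR n <= 2 ^ n).
  { clear. induction n; [simpl; lra|]. rewrite S_INR. simpl.
    assert (1 <= 2 ^ n) by (apply pow_R1_Rle; lra). lra. }
  apply Rmult_le_reg_l with (r / 2); [lra|]. eapply Rle_trans; [exact hp|].
  replace (r / 2 * (Rabs (b' - b) / (r / 2) * r ^ n)) with (Rabs (b' - b) * r ^ n) by (field; lra).
  apply Rmult_le_compat_l; [apply Rabs_pos|].
  replace (r ^ n) with (2 ^ n * (r / 2) ^ n) by (rewrite <- Rpow_mult_distr; f_equal; field).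
  apply Rmult_le_compat_r; [apply pow_le; lra|exact h2].
Qed.

Definition pow_tail (b : R) (n : nat) : R :=
  match n with S (S _) => b ^ n | _ => 0 end.

Lemma dominated_pow_tail r b : 0 < r -> 0 <= b <= r ->
  dominated r (pow_tail b) (b ^ 2 / r ^ 2).
Proof.
  intros hr h n.
  assert (0 < r ^ 2) by (apply pow_lt; lra).
  assert (0 <= b ^ 2 / r ^ 2) by (apply Rdiv_le_0_compat; [apply pow2_ge_0|assumption]).
  assert (hp : forall m, 0 <= b ^ m <= r ^ m).
  { intros m. split; [apply pow_le|apply pow_incr]; lra. }
  destruct n as [|[|n]]; cbn [pow_tail].
  1,2: rewrite Rabs_R0; apply Rmult_le_pos; [assumption|apply pow_le; lra].
  rewrite Rabs_pos_eq by apply hp.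
  replace (b ^ S (S n)) with (b ^ 2 * b ^ n) by (simpl; ring).
  replace (b ^ 2 / r ^ 2 * r ^ S (S n)) with (b ^ 2 * r ^ n) by (simpl; field; lra).
  apply Rmult_le_compat_l; [apply pow2_ge_0|apply hp].
Qed.

(** * Series of trigonometric polynomials of growing degree *)

Section TrigSeries.

Context (nu k B M : R) (F : nat -> trigpoly).
Hypothesis hnu : 0 <= nu.
Hypothesis hk : 0 <= k.
Hypothesis hM : 1 <= M.
Hypothesis hdeg : forall n, deg_le n (F n).
Hypothesis hnorm : forall n, norm1 (F n) <= B * M ^ n.

Definition tseries (i l n : nat) (t s : R) : R := pairing (dmode nu k i l t s) (F n).

Definition tbound (i l : nat) : R := nu ^ i * k ^ l * INR (S (i + l)) ^ (i + l) * B.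

Lemma tseries_dt i l n t s : is_derive (fun x => tseries i l n x s) t (tseries (S i) l n t s).
Proof. apply is_derive_pairing. intros; apply is_derive_dmode_t. Qed.

Lemma tseries_ds i l n t s : is_derive (fun y => tseries i l n t y) s (tseries i (S l) n t s).
Proof. apply is_derive_pairing. intros; apply is_derive_dmode_s. Qed.

Lemma tseries_bound i l n t s : Rabs (tseries i l n t s) <= tbound i l * (3 * M) ^ n.
Proof.
  assert (h1 : 0 <= nu ^ i * k ^ l) by (apply Rmult_le_pos; apply pow_le; assumption).
  eapply Rle_trans; [apply (pairing_bound _ (nu ^ i * k ^ l * INR n ^ (i + l)))|].
  - intros c [j m] hin. pose proof (hdeg n) as hd. unfold deg_le in hd.
    rewrite List.Forall_forall in hd. destruct (hd _ hin) as [hj hm].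
    now apply dmode_bound.
  - unfold tbound. pose proof (pow_le_exponential n (i + l)) as he.
    rewrite Rpow_mult_distr.
    replace (nu ^ i * k ^ l * INR (S (i + l)) ^ (i + l) * B * (3 ^ n * M ^ n))
      with (nu ^ i * k ^ l * (INR (S (i + l)) ^ (i + l) * 3 ^ n) * (B * M ^ n)) by ring.
    apply Rmult_le_compat; [|apply norm1_nonneg| |apply hnorm].
    + apply Rmult_le_pos; [assumption|apply pow_le, pos_INR].
    + now apply Rmult_le_compat_l.
Qed.

Lemma radius_rho : / (6 * M) * (3 * M) = / 2.
Proof. field. lra. Qed.

End TrigSeries.

(** * Summation of the formal solution *)

Section Branch.

Context (nu k a K : R) (mu : Z * Z -> R).
Hypothesis hnu : 0 <= nu.
Hypothesis hk : 0 <= k.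
Hypothesis ha : 0 < a.
Hypothesis h11 : symbol a nu k (1, 1)%Z = 0.
Hypothesis hmu : forall jm, mu jm * symbol a nu k jm =
  if is_kernel jm then 0 else (IZR (snd jm) * k) ^ 2.
Hypothesis hK : forall jm, Rabs (mu jm) <= K.

(** The clause with [mode] says that U sees (t, s) only through the values of the modes;
    periodicity, evenness and the shift symmetry are all read off from it. *)
Lemma branch : exists (b0 : R) (U : R -> R -> R -> R),
  0 < b0 /\
  continuous_family b0 (fun b t s => RtoC (U b t s)) /\
  (forall t s, U 0 t s = a) /\
  (forall b, 0 <= b <= b0 -> is_solution (fun t s => RtoC (U b t s))) /\
  (forall t s t' s', (forall jm, mode (nu * t) (k * s) jm = mode (nu * t') (k * s') jm) ->
     forall b, U b t s = U b t' s') /\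
  (exists K, forall b, 0 <= b <= b0 ->
     Cn_norm_le 4 (fun t s => RtoC (U b t s) -
       RtoC (a + b * cos (nu * t) * cos (k * s))%R)%C (K * b ^ 2)).
Proof.
  destruct (course_of_values ([], []) (next a mu) (next_ext a mu)) as [f hf].
  destruct (coefficients_growth a K mu f ha hf hK) as (B & M & hB & hM & hg).
  set (u := fun n => fst (f n)). set (v := fun n => snd (f n)).
  assert (hdu : forall n, deg_le n (u n)) by (intros n; apply (deg_le_coefficients a mu f hf n)).
  assert (hdv : forall n, deg_le n (v n)) by (intros n; apply (deg_le_coefficients a mu f hf n)).
  assert (hnu' : forall n, norm1 (u n) <= B * M ^ n) by (intros; apply hg).
  assert (hnv' : forall n, norm1 (v n) <= B * M ^ n) by (intros; apply hg).
  assert (hu0 : u 0%nat = [(a, (0, 0)%Z)]) by exact (u_0 a mu f hf).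
  assert (hu1 : u 1%nat = phi) by exact (u_1 a mu f hf).
  assert (hv0 : v 0%nat = [(/ a, (0, 0)%Z)]) by exact (v_0 a mu f hf).
  assert (huv0 : forall x y n, (1 <= n)%nat -> sum_f_R0 (fun i =>
      pairing (mode x y) (u i) * pairing (mode x y) (v (n - i)%nat)) n = 0)
    by exact (product_zero a mu f ha hf).
  set (r := / (6 * M)).
  assert (hr : 0 < r) by (apply Rinv_0_lt_compat; lra).
  set (gu := tseries nu k u). set (gv := tseries nu k v). set (Kb := tbound nu k B).
  pose proof (tseries_dt nu k u) as dtu. pose proof (tseries_ds nu k u) as dsu.
  pose proof (tseries_dt nu k v) as dtv. pose proof (tseries_ds nu k v) as dsv.
  pose proof (tseries_bound nu k B M u hnu hk hdu hnu') as bu.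
  pose proof (tseries_bound nu k B M v hnu hk hdv hnv') as bv.
  pose proof (radius_rho M hM) as hrho. fold r in hrho. fold gu Kb in dtu, dsu, bu.
  fold gv Kb in dtv, dsv, bv.
  assert (hgu0 : forall t s, gu 0%nat 0%nat 0%nat t s = a).
  { intros. unfold gu, tseries. rewrite hu0. unfold pairing. simpl.
    rewrite dmode_00. unfold mode. simpl. rewrite !Rmult_0_l, cos_0. ring. }
  assert (hgu1 : forall t s, gu 0%nat 0%nat 1%nat t s = cos (nu * t) * cos (k * s)).
  { intros. unfold gu, tseries. rewrite hu1. unfold pairing. simpl.
    rewrite dmode_00. unfold mode. simpl. rewrite !Rmult_1_l. ring. }
  assert (hpow : forall b, 0 <= b <= r / 2 -> dominated r (fun n => b ^ n) 1).
  { intros b hb. apply dominated_pow. lra. }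
  assert (ex : forall be E, dominated r be E -> forall t s, ex_series (fun n => be n * gu 0%nat 0%nat n t s)).
  { intros be E h t s. now apply (ex_series_fsum gu Kb r (3 * M) bu hrho be E). }
  destruct (Cn_norm_le_fsum gu Kb r (3 * M) dtu dsu bu hrho 4) as (C & hC & hCn).
  exists (r / 2), (fun b => fsum gu (fun n => b ^ n) 0 0).
  split; [lra|]. split; [|split; [|split; [|split]]].
  - intros b hb eps heps.
    assert (hd : 0 < eps * (r / 2) / (C + 1)).
    { apply Rdiv_lt_0_compat; [apply Rmult_lt_0_compat|]; lra. }
    exists (eps * (r / 2) / (C + 1)). split; [exact hd|]. intros b' hb' hbb.
    replace (fun t s : R => Cminus (fsum gu (fun n => b' ^ n) 0 0 t s)
        (fsum gu (fun n => b ^ n) 0 0 t s))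
      with (fun t s : R => RtoC (fsum gu (fun n => b' ^ n - b ^ n) 0 0 t s)).
    + eapply Cn_norm_le_weaken; [apply hCn, dominated_pow_diff; assumption|].
      apply Rlt_div_r in hbb; [|lra].
      replace (Rabs (b' - b) / (r / 2) * C) with (Rabs (b' - b) * C / (r / 2)) by (field; lra).
      apply Rle_div_l; [lra|]. pose proof (Rabs_pos (b' - b)). nra.
    + do 2 (apply functional_extensionality; intro). rewrite <- RtoC_minus. f_equal.
      unfold fsum. rewrite <- Series_minus by (eapply ex; apply hpow; assumption).
      apply Series_ext. intros n. ring.
  (* At b = 0 the weight 0^0 is 1, so exactly order 0 survives. *)
  - intros t s. unfold fsum. rewrite Series_incr_1 by (eapply ex; apply hpow; lra).
    rewrite hgu0. rewrite (Series_ext _ (fun n => 0 * 0)) by (intros; simpl; ring).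
    rewrite Series_scal_l. simpl. ring.
  - intros b hb. specialize (hpow b hb).
    (* By the Cauchy product, all orders n >= 1 of u v vanish and order 0 is a / a. This yields both
       that u has no zeros and that v is the nonlinearity evaluated at u. *)
    assert (huv : forall t s, fsum gu (fun n => b ^ n) 0 0 t s * fsum gv (fun n => b ^ n) 0 0 t s = 1).
    { intros t s.
      pose proof (is_series_mult _ _ _ _
        (Series_correct _ (ex_series_fsum gu Kb r (3 * M) bu hrho _ _ 0 0 t s hpow))
        (Series_correct _ (ex_series_fsum gv Kb r (3 * M) bv hrho _ _ 0 0 t s hpow))
        (ex_series_fsum_abs gu Kb r (3 * M) bu hrho _ _ 0 0 t s hpow)
        (ex_series_fsum_abs gv Kb r (3 * M) bv hrho _ _ 0 0 t s hpow)) as hm.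
      apply is_series_unique in hm. unfold fsum. rewrite <- hm.
      rewrite (Series_ext _ (fun n => b ^ n * sum_f_R0 (fun i => pairing (mode (nu * t) (k * s)) (u i)
         * pairing (mode (nu * t) (k * s)) (v (n - i)%nat)) n)).
      - rewrite Series_incr_1.
        + rewrite (Series_ext _ (fun n => 0 * 0)).
          * rewrite Series_scal_l. simpl. rewrite hu0, hv0. unfold pairing, mode. simpl.
            rewrite !Rmult_0_l, cos_0. field. lra.
          * intros n. rewrite huv0 by lia. ring.
        + apply ex_series_incr_1. apply ex_series_ext with (fun n => 0 * (/ 2) ^ n).
          * intros n. rewrite huv0 by lia. now rewrite Rmult_0_l, Rmult_0_r.
          * apply (ex_series_scal (K := R_AbsRing) (V := R_NormedModule)).
            apply ex_series_geom. rewrite Rabs_pos_eq; lra.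
      - intros n. rewrite scal_sum. apply sum_eq. intros i hi.
        replace (b ^ n) with (b ^ i * b ^ (n - i)) by (rewrite <- pow_add; f_equal; lia).
        unfold gu, gv, tseries.
        replace (dmode nu k 0 0 t s) with (mode (nu * t) (k * s))
          by (apply functional_extensionality; intros; symmetry; apply dmode_00).
        ring. }
    assert (hne : forall t s, fsum gu (fun n => b ^ n) 0 0 t s <> 0).
    { intros t s e. specialize (huv t s). rewrite e in huv. lra. }
    split; [|split].
    + now apply (is_Cn_fsum gu Kb r (3 * M) dtu dsu bu hrho _ 1).
    + intros t s e. apply (hne t s). now injection e.
    + intros t s.
      replace (nonlinearity (fun t s => RtoC (fsum gu (fun n => b ^ n) 0 0 t s)))
        with (fun t s => RtoC (fsum gv (fun n => b ^ n) 0 0 t s)).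
      * rewrite (iter_Dt_fsum gu Kb r (3 * M) dtu bu hrho _ 1) by assumption.
        rewrite (iter_Ds_fsum gu Kb r (3 * M) dsu bu hrho _ 1) by assumption.
        rewrite (iter_Ds_fsum gv Kb r (3 * M) dsv bv hrho _ 1) by assumption.
        rewrite <- RtoC_opp, <- RtoC_plus. f_equal.
        assert (e : fsum gu (fun n => b ^ n) 2 0 t s + fsum gu (fun n => b ^ n) 0 4 t s
                 = fsum gv (fun n => b ^ n) 0 2 t s).
        { unfold fsum. rewrite <- Series_plus
            by (eapply (ex_series_fsum gu Kb r (3 * M) bu hrho); eassumption).
          apply Series_ext. intros n. rewrite <- Rmult_plus_distr_l. f_equal.
          now apply (wave_equation a mu f ha hf). }
        simpl Nat.add. lra.
      * do 2 (apply functional_extensionality; intro). unfold nonlinearity.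
        rewrite Cmod_R, pow2_abs, <- RtoC_mult. f_equal.
        specialize (huv x x0). specialize (hne x x0).
        apply Rmult_eq_reg_l with (fsum gu (fun n => b ^ n) 0 0 x x0); [|assumption].
        rewrite huv. field. assumption.
  - intros t s t' s' h b. unfold fsum. apply Series_ext. intros n. f_equal.
    unfold gu, tseries, pairing. apply lsum_ext. intros x _.
    now rewrite !dmode_00, h.
  - exists (C / r ^ 2). intros b hb.
    replace (fun t s : R => Cminus (fsum gu (fun n => b ^ n) 0 0 t s)
        (a + b * cos (nu * t) * cos (k * s))%R)
      with (fun t s : R => RtoC (fsum gu (pow_tail b) 0 0 t s)).
    + replace (C / r ^ 2 * b ^ 2) with (b ^ 2 / r ^ 2 * C) by (field; lra).
      apply hCn, dominated_pow_tail; lra.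
    + do 2 (apply functional_extensionality; intro). rewrite <- RtoC_minus. f_equal.
      unfold fsum.
      assert (h1 := ex _ _ (hpow b hb) x x0).
      assert (h2 := ex _ _ (dominated_pow_tail r b hr ltac:(lra)) x x0).
      rewrite (Series_incr_1 _ h1), (Series_incr_1 _ h2).
      apply ex_series_incr_1 in h1, h2.
      rewrite (Series_incr_1 _ h1), (Series_incr_1 _ h2).
      rewrite hgu0, hgu1. cbn [pow_tail]. simpl pow. ring.
Qed.

End Branch.

Theorem theorem1 (q : nat) (hq : (0 < q)%nat) :
  (forall m : nat, exists k0 : nat, (m < k0)%nat /\
     exists a0 : R, is_amplitude q k0 a0 /\
       nonresonant (freq_nu q k0) a0 1 k0 0)
  /\
  (forall (k0 : nat) (a0 : R),
     (0 < k0)%nat ->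
     is_amplitude q k0 a0 ->
     nonresonant (freq_nu q k0) a0 1 k0 0 ->
     exists (b0 : R) (w : R -> R -> R -> C),
       0 < b0 /\
       continuous_family b0 w /\
       (forall t s : R, w 0 t s = RtoC a0) /\
       (forall b : R, 0 <= b <= b0 ->
          is_solution (w b) /\
          periodic_t (2 * PI * INR q / IZR (freq_p q k0)) (w b) /\
          periodic_s (2 * PI) (w b) /\
          standing_wave_symmetries (freq_p q k0) q k0 0 (w b)) /\
       (exists K : R, forall b : R, 0 <= b <= b0 ->
          Cn_norm_le 4
            (fun t s => w b t s - leading_term (freq_p q k0) q k0 0 a0 b t s)%C
            (K * b ^ 2))).
Proof.
  split.
  (* Any [k0 >= 2] is admissible, and m + 2 also exceeds m. *)
  - intros m. exists (S (S m)). split; [lia|].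
    destruct (amplitude_exists q (S (S m)) hq ltac:(lia)) as [a0 ha].
    exists a0. split; [exact ha|]. now apply nonresonant_freq; [|lia|].
  - intros k0 a0 hk ha hn.
    pose proof (nonresonant_freq_pos q k0 a0 hq hk hn) as hp. apply IZR_lt in hp.
    assert (hq' : 0 < INR q) by now apply lt_0_INR.
    assert (hk' : 0 < INR k0) by now apply lt_0_INR.
    set (nu := freq_nu q k0).
    assert (hnu : 0 < nu) by now apply Rdiv_lt_0_compat.
    destruct (branch nu (INR k0) a0 _ (resolvent a0 nu (INR k0)) (Rlt_le _ _ hnu)
      (Rlt_le _ _ hk') (proj1 ha) (symbol_one q k0 a0 hq hk hn)
      (resolvent_symbol q k0 a0 hq hk hn) (resolvent_bound q k0 a0 hq hk ha hn))
      as (b0 & U & hb0 & hcont & h0 & hsol & hsym & (K & hlead)).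
    exists b0, (fun b t s => RtoC (U b t s)).
    split; [exact hb0|]. split; [exact hcont|]. split; [intros; now rewrite h0|].
    split.
    + intros b hb. split; [now apply hsol|].
      assert (hs : forall t s, U b t (s + 2 * PI / INR k0) = U b t s).
      { intros t s. apply hsym. intros jm.
        replace (INR k0 * (s + 2 * PI / INR k0)) with (INR k0 * s + 2 * PI) by (field; lra).
        apply mode_periodic_r. }
      split; [|split; [|intros t s; split; [|split; [|split]]]].
      * intros t s. f_equal. apply hsym. intros jm.
        replace (nu * (t + 2 * PI * INR q / IZR (freq_p q k0))) with (nu * t + 2 * PI).
        -- apply mode_periodic_l.
        -- unfold nu, freq_nu. field. split; lra.
      * intros t s. f_equal.
        (* The period 2 pi is [k0] times the period 2 pi / k0 already established. *)
        assert (hi : forall i, U b t (s + INR i * (2 * PI / INR k0)) = U b t s).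
        { induction i as [|i IH]; [simpl INR; now rewrite Rmult_0_l, Rplus_0_r|].
          rewrite <- IH, <- (hs t (s + INR i * (2 * PI / INR k0))), S_INR. f_equal. ring. }
        rewrite <- (hi k0). f_equal. field. lra.
      * f_equal. apply hsym. intros jm. rewrite Ropp_mult_distr_r_reverse.
        symmetry. apply mode_opp_l.
      * f_equal. apply hsym. intros jm. rewrite (Ropp_mult_distr_r_reverse (INR k0)).
        symmetry. apply mode_opp_r.
      * f_equal. symmetry. apply hs.
      * simpl INR. rewrite Rmult_0_l, Rplus_0_r. unfold Cconj, RtoC. simpl. now rewrite Ropp_0.
    + exists K. intros b hb. specialize (hlead b hb).
      replace (fun t s : R => (RtoC (U b t s) -
          leading_term (freq_p q k0) q k0 0 a0 b t s)%C)
        with (fun t s : R => (RtoC (U b t s) -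
          RtoC (a0 + b * cos (nu * t) * cos (INR k0 * s))%R)%C); [exact hlead|].
      do 2 (apply functional_extensionality; intro). f_equal.
      unfold leading_term. rewrite RtoC_plus. f_equal. simpl Cpow.
      rewrite Cmult_1_l. do 4 f_equal. unfold nu, freq_nu. field. lra.
Qed.
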